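(* Let $\theta^*=2\beta/(c_a^2+c_s^2)$, and let $(\hat Q,\hat{\mathbf L})$ be distributed according to $\pi_*$, the unique stationary distribution of the Markov chain $\{(\hat Q_t,\hat{\mathbf L}_t),t\in\mathbb Z_+\}$. Then $\mathbb E e^{\theta\hat Q}<\infty$ if $\theta<\theta^*$, and $\mathbb E e^{\theta\hat Q}=\infty$ if $\theta>\theta^*$.
   Context: $S$ is a random variable (service time) with values in $\{1,\dots,K\}$; $p_i=\Pr[S=i]$, $p_0=0$, $p_K>0$, $\mathbf p=(p_1,\dots,p_K)$; $1/\mu=\mathbb E S$; $\sigma_s^2=\mathrm{Var}(S)>0$; $c_s=\mu\sigma_s$; there are relatively prime $i\ne j$ with $p_ip_j>0$. $\beta>0$ and $c_a\in[0,\infty)$ are constants. Limiting chain. Let $\{\hat A_t\}$ be i.i.d. normal with mean $0$ and variance $\mu c_a^2$, and let $\{\hat{\mathbf J}_t\}$ be i.i.d. normal vectors in $\mathbb R^K$ with mean zero and covariance $\mu\Sigma$, where $\Sigma_{ii}=p_i(1-p_i)$ and $\Sigma_{ij}=-p_ip_j$ for $i\ne j$; the two sequences are independent. Let $\mathcal T(x_1,\dots,x_K)=(x_2,\dots,x_K,0)$. The chain $\{(\hat Q_t,\hat{\mathbf L}_t),t\in\mathbb Z_+\}$ on $\mathbb R^{K+1}$ is defined by $$\hat{\mathbf L}_{t+1}=\mathcal T\{\hat{\mathbf L}_t\}+\hat{\mathbf J}_{t+1}+\hat J_{t+1}\mathbf p,\quad \hat Q_{t+1}=\Big(\hat Q_t+\hat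 A_{t+1}+\sum_{k=2}^K\hat L_{t,k}-\beta\Big)^+,\quad \hat J_{t+1}=\big(\hat Q_t+\hat A_{t+1}\big)\wedge\Big(\beta-\sum_{k=2}^K\hat L_{t,k}\Big)$$ (here $\hat J_{t+1}$ is a scalar, distinct from the vector $\hat{\mathbf J}_{t+1}$), with initial condition $(\hat Q_0,\hat{\mathbf L}_0)$ independent of $\{\hat A_t\},\{\hat{\mathbf J}_t\}$ and satisfying $\sum_{k=1}^K\hat L_{0,k}\le\beta$ and $\hat Q_0(\sum_{k=1}^K\hat L_{0,k}-\beta)=0$. This chain has a unique stationary distribution, denoted $\pi_*$. (It is the weak limit of the stationary laws of the scaled queue length and service vectors of $n$-server queues with service time $S$, limiting interarrival coefficient of variation $c_a$ and Halfin-Whitt parameter $\beta$.) *)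

(* Defs.v *)
From HB Require Import structures.
From mathcomp Require Import all_boot all_order all_algebra.
From mathcomp Require Import all_classical all_reals all_analysis.

Set Implicit Arguments.
Unset Strict Implicit.
Unset Printing Implicit Defensive.
Import Order.TTheory GRing.Theory Num.Theory.
Import numFieldNormedType.Exports.
Local Open Scope classical_set_scope.
Local Open Scope ring_scope.

Section service_time.
Context {R : realType} {d : measure_display} {T : measurableType d}
        {P : probability T R}.
Implicit Type S : {RV P >-> nat}.

Definition service_pmf S (k : nat) : R := fine (P (S @^-1` [set k])).

Definition service_rate S : R := (fine 'E_P[fun w => (S w)%:R])^-1.

Definition service_var S : R := fine 'V_P[fun w => (S w)%:R].

Definition service_cv S : R := service_rate S * Num.sqrt (service_var S).

End service_time.

Section limit_chain.
Context {R : realType} {K : nat}.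

(* A mean-zero normal law with variance [v >= 0] is the point mass at 0 when
   [v = 0]; [normal_prob 0 0] is not (it is uniform on [0, 1]). *)
Definition centered_normal (v : R) : set R -> \bar R :=
  if v == 0 then \d_(0 : R) else normal_prob 0 (Num.sqrt v).

Definition is_centered_normal {d : measure_display} {T : measurableType d}
    (P : probability T R) (v : R) (X : T -> R) : Prop :=
  forall B : set R, measurable B -> P (X @^-1` B) = centered_normal v B.

(* Joint normality, possibly degenerate: every linear combination of the
   coordinates is a (possibly degenerate) normal variable. *)
Definition is_centered_normal_vector {d : measure_display}
    {T : measurableType d} (P : probability T R) (C : 'M[R]_K)
    (X : T -> K.-tuple R) : Prop :=
  forall a : 'rV[R]_K,
    is_centered_normal P ((a *m C *m a^T) 0 0)
      (fun w => \sum_(i < K) a 0 i * tnth (X w) i).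

(* Below, index [i : 'I_K] stands for the service time [i.+1]. *)

Definition multinomial_cov (p : nat -> R) : 'M[R]_K :=
  \matrix_(i, j) (if i == j then p i.+1 * (1 - p i.+1) else - (p i.+1 * p j.+1)).

Definition shift (l : K.-tuple R) : K.-tuple R :=
  [tuple nth 0 l i.+1 | i < K].

(* the sum over the service times 2, ..., K *)
Definition remaining (l : K.-tuple R) : R := \sum_(i < K | (0 < i)%N) tnth l i.

Definition total (l : K.-tuple R) : R := \sum_(i < K) tnth l i.

Definition entering (beta q : R) (l : K.-tuple R) (a : R) : R :=
  Num.min (q + a) (beta - remaining l).

Definition next_queue (beta q : R) (l : K.-tuple R) (a : R) : R :=
  Num.max (q + a + remaining l - beta) 0.

Definition next_service (p : nat -> R) (beta q : R) (l : K.-tuple R) (a : R)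
    (j : K.-tuple R) : K.-tuple R :=
  [tuple tnth (shift l) i + tnth j i + entering beta q l a * p i.+1 | i < K].

(* Mutual independence of a family of set systems (here sigma-algebras). *)
Definition mutually_independent {d : measure_display} {T : measurableType d}
    (P : probability T R) {I : choiceType} (F : I -> set (set T)) : Prop :=
  forall (s : seq I) (E : I -> set T), uniq s ->
    (forall i, i \in s -> F i (E i)) ->
    P (\bigcap_(i in [set` s]) E i) = (\prod_(i <- s) P (E i))%E.

Definition sigma_of {d d' : measure_display} {T : measurableType d}
    {T' : measurableType d'} (X : T -> T') : set (set T) :=
  preimage_set_system setT X measurable.

(* The initial state and all the noise variables [A t], [J t] form one mutually
   independent family. *)
Definition is_limit_chain (p : nat -> R) (mu ca beta : R)
    {d : measure_display} {T : measurableType d} (P : probability T R)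
    (Q : nat -> {RV P >-> R}) (L : nat -> {RV P >-> K.-tuple R})
    (A : nat -> {RV P >-> R}) (J : nat -> {RV P >-> K.-tuple R}) : Prop :=
  [/\ forall t, is_centered_normal P (mu * ca ^+ 2) (A t),
      forall t, is_centered_normal_vector P (mu *: multinomial_cov p) (J t),
      mutually_independent P (fun i : option (nat + nat) =>
        match i with
        | None => sigma_of (fun w => (Q 0%N w, L 0%N w))
        | Some (inl t) => sigma_of (A t)
        | Some (inr t) => sigma_of (J t)
        end),
      {ae P, forall w, total (L 0%N w) <= beta /\
                       Q 0%N w * (total (L 0%N w) - beta) = 0} &
      forall t w,
        Q t.+1 w = next_queue beta (Q t w) (L t w) (A t.+1 w) /\
        L t.+1 w =
          next_service p beta (Q t w) (L t w) (A t.+1 w) (J t.+1 w)].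

(* [pistar] is stationary: some realization of the chain, on some probability
   space, has law [pistar] at every time. *)
Definition is_stationary_distribution (p : nat -> R) (mu ca beta : R)
    (pistar : probability (R * K.-tuple R)%type R) : Prop :=
  exists (d : measure_display) (T : measurableType d) (P : probability T R)
         (Q : nat -> {RV P >-> R}) (L : nat -> {RV P >-> K.-tuple R})
         (A : nat -> {RV P >-> R}) (J : nat -> {RV P >-> K.-tuple R}),
    is_limit_chain p mu ca beta Q L A J /\
    forall (t : nat) (B : set (R * K.-tuple R)), measurable B ->
      P ((fun w => (Q t w, L t w)) @^-1` B) = pistar B.

End limit_chain.

(* Main.v *)
Require Import Defs.
From HB Require Import structures.
From mathcomp Require Import all_boot all_order all_algebra.
From mathcomp Require Import ring lra.
From mathcomp Require Import all_classical all_reals all_analysis.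
From mathcomp Require Import measurable_realfun.
Set Implicit Arguments.
Unset Strict Implicit.
Unset Printing Implicit Defensive.
Import Order.TTheory GRing.Theory Num.Theory.
Import numFieldNormedType.Exports.
Local Open Scope classical_set_scope.
Local Open Scope ring_scope.

(* Let [w] be the function "residual service time".  The workload [<w, L> + m Q],
   [m] the mean service time, changes per step by a centered normal variable of
   variance [m (ca^2 + cs^2)] minus the number in service, which is [beta]
   whenever [Q > 0]; this is a random walk with negative drift, whose critical
   exponent is [theta_star].

   To make this rigorous, compare the chain with the system in which freed
   capacity is refilled at once.  Its service vector is an autonomous linear
   recursion driven by the normal noise, and with [N] its cumulative arrivals
   minus entries into service, pathwise
     [Q_0 - (beta - total L_0) + N_t <= Q_t <=
        max (Q_0 + N_t) (max_(0 < s <= t) (N_t - N_s))].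
   The increments of [N] are those of the random walk up to an error
   [<W_s - W_t, .>], where [W_n] is the image of [w] under [n] steps of the
   transition operator of the residual service time.  By aperiodicity (the
   coprimality assumption) that operator is a strict contraction for the
   oscillation, so the error affects the exponential moments of [N_t - N_s] only
   by a bounded factor and the initial state is forgotten geometrically fast.
   Stationarity then allows [t] to be chosen after the truncation levels. *)

(** * The residual service time operator *)

Lemma bernoulli_ge (R : realFieldType) (x : R) (n : nat) :
  0 <= x <= 1 -> 1 - n%:R * x <= (1 - x) ^+ n.
Proof.
move=> /andP[x0 x1]; elim: n => [|n IH]; first by rewrite mul0r subr0 expr0.
rewrite exprS; apply: le_trans (_ : (1 - x) * (1 - n%:R * x) <= _).
  have : 0 <= n%:R * (x * x) by rewrite !mulr_ge0.
  by rewrite -natr1; lra.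
by apply: ler_wpM2l => //; lra.
Qed.

(** By the Chinese remainder theorem some [x < i * j] is congruent to [n] modulo [i] and to 0 modulo
    [j]. Then [x <= n], and [n - x] and [x] are the two multiples. *)
Lemma coprime_comb (i j n : nat) : coprime i j -> (0 < i)%N -> (0 < j)%N ->
  (i * j <= n)%N -> exists a b : nat, n = (a * i + b * j)%N.
Proof.
move=> cij i0 j0 ijn; set x := (chinese i j n 0 %% (i * j))%N.
have xi : x = n %[mod i].
  by rewrite /x modn_dvdm ?dvdn_mulr// chinese_modl.
have xj : (j %| x)%N.
  by rewrite /dvdn /x modn_dvdm ?dvdn_mull// chinese_modr// mod0n.
have xn : (x <= n)%N.
  by apply: leq_trans ijn; rewrite ltnW// ltn_mod muln_gt0 i0.
have /dvdnP[a ha] : (i %| n - x)%N by rewrite -eqn_mod_dvd//; apply/eqP.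
have /dvdnP[b hb] := xj.
by exists a, b; rewrite -ha -hb subnK.
Qed.

Section renewal_operator.
Variables (R : realFieldType) (K : nat) (q : nat -> R).
Implicit Types f g : nat -> R.

(* Acts on functions of the residual service time [k.+1], [k < K]: a residual
   time decreases by one, and one that expires is redrawn from [q]. *)
Definition renew f (k : nat) : R :=
  if k is k'.+1 then f k' else \sum_(i < K) q i * f i.

Hypothesis q_ge0 : forall i, 0 <= q i.
Hypothesis q_sum1 : \sum_(i < K) q i = 1.

Lemma renew_bounds f a b : (forall k, (k < K)%N -> a <= f k <= b) ->
  forall n k, (k < K)%N -> a <= iter n renew f k <= b.
Proof.
move=> fab; elim=> [//|n IH] [|k] kK; last by rewrite iterS /=; exact/IH/ltnW.
rewrite iterS /=; apply/andP; split.
  rewrite -[leLHS]mul1r -q_sum1 mulr_suml; apply: ler_sum => i _.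
  by apply: ler_wpM2l => //; case/andP: (IH i (ltn_ord i)).
rewrite -[leRHS]mul1r -q_sum1 mulr_suml; apply: ler_sum => i _.
by apply: ler_wpM2l => //; case/andP: (IH i (ltn_ord i)).
Qed.

Lemma renew_ge0 f : (forall k, (k < K)%N -> 0 <= f k) ->
  forall n k, (k < K)%N -> 0 <= iter n renew f k.
Proof.
move=> f0; elim=> [//|n IH] [|k] kK; last by rewrite iterS /=; exact/IH/ltnW.
by rewrite iterS /=; apply: sumr_ge0 => i _; rewrite mulr_ge0// IH.
Qed.

Lemma iter_renew_addn f n k : iter n renew f (n + k)%N = f k.
Proof. by elim: n => [|n IH]//; rewrite iterS addSn /=. Qed.

Lemma iter_renew_affine f a b n k :
  iter n renew (fun i => a * f i + b) k = a * iter n renew f k + b.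
Proof.
elim: n k => [//|n IH] [|k]; rewrite !iterS /=; last exact: IH.
under eq_bigr do rewrite IH mulrDr mulrCA.
by rewrite big_split /= -mulr_sumr -mulr_suml q_sum1 mul1r.
Qed.

(** From residual index 0 a redraw gives index [i] with weight [q i], which is back at 0 after [i]
    more steps. The bound keeps only the path made of [n] such loops. *)
Lemma iter_renew_return f i n : (i < K)%N ->
  (forall k, (k < K)%N -> 0 <= f k) ->
  q i ^+ n * f 0%N <= iter (n * i.+1) renew f 0%N.
Proof.
move=> iK f0; elim: n => [|n IH]; first by rewrite mul0n expr0 mul1r.
rewrite exprS -mulrA mulSn iterD.
apply: le_trans (_ : q i * iter (n * i.+1) renew f 0%N <= _).
  exact: ler_wpM2l.
set g := iter _ renew f; rewrite iterS /= (bigD1 (Ordinal iK)) //=.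
have -> : iter i renew g i = g 0%N by rewrite -{2}[i]addn0 iter_renew_addn.
rewrite lerDl; apply: sumr_ge0 => l _.
by rewrite mulr_ge0// renew_ge0// => k kK; exact: renew_ge0.
Qed.

(** A Doeblin minorization: index [k] runs down to 0 in [k] steps, and the remaining [N - k] steps,
    at least [i.+1 * j.+1] of them, split into loops of lengths [i.+1] and [j.+1]. *)
Lemma renew_doeblin i j : coprime i.+1 j.+1 -> (i < K)%N -> (j < K)%N ->
  0 < q i -> 0 < q j ->
  exists (N : nat) (eps : R), [/\ (0 < N)%N, 0 < eps, eps <= 1 / 2 &
    forall f, (forall k, (k < K)%N -> 0 <= f k) ->
    forall k, (k < K)%N -> eps * f 0%N <= iter N renew f k].
Proof.
move=> cij iK jK qi qj.
have q_le1 l : (l < K)%N -> q l <= 1.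
  move=> lK; rewrite -q_sum1 (bigD1 (Ordinal lK)) //= lerDl.
  exact: sumr_ge0.
pose N := (i.+1 * j.+1 + K)%N.
pose e := (q i * q j) ^+ N.
have e0 : 0 < e by rewrite exprn_gt0// mulr_gt0.
have e1 : e <= 1.
  by rewrite exprn_ile1 ?mulr_ge0// mulr_ile1// q_le1.
(* Halving [e] secures [eps <= 1 / 2], which later keeps the contraction rate positive. *)
exists N, (e / 2); split=> [|||f f0 k kK]; [by []|lra|lra|].
have kN : (k <= N)%N by rewrite (leq_trans (ltnW kK))// leq_addl.
have [a [b nab]] : exists a b, (N - k)%N = (a * i.+1 + b * j.+1)%N.
  apply: coprime_comb => //; rewrite /N -addnBA ?leq_addr//; exact: ltnW.
have -> : iter N renew f k = iter (N - k) renew f 0%N.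
  have := iter_renew_addn (iter (N - k) renew f) k 0.
  by rewrite addn0 -iterD subnKC.
have aN : (a <= N)%N.
  rewrite -(subnK kN) nab (leq_trans _ (leq_addr _ _))//.
  by rewrite (leq_trans _ (leq_addr _ _))// leq_pmulr.
have bN : (b <= N)%N.
  rewrite -(subnK kN) nab (leq_trans _ (leq_addr _ _))//.
  by rewrite (leq_trans _ (leq_addl _ _))// leq_pmulr.
have f00 : 0 <= f 0%N by apply: f0; apply: leq_ltn_trans kK.
apply: le_trans (_ : e * f 0%N <= _).
  apply: ler_wpM2r => //; lra.
rewrite nab iterD.
apply: le_trans (iter_renew_return _ iK _); last exact: renew_ge0.
apply: le_trans (_ : q i ^+ a * (q j ^+ b * f 0%N) <= _); last first.
  by apply: ler_wpM2l; rewrite ?exprn_ge0// iter_renew_return.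
rewrite mulrA; apply: ler_wpM2r => //; rewrite /e exprMn.
apply: ler_pM; rewrite ?exprn_ge0//.
  by apply: ler_wiXn2l => //; exact: q_le1.
by apply: ler_wiXn2l => //; exact: q_le1.
Qed.

(** The minorization applied to [f - a] and to [b - f] shrinks an interval containing the values of
    [f] by the factor [1 - eps] every [N] steps. Later iterates stay in the interval reached at time
    [n], whence the comparison with every [m >= n]. *)
Lemma renew_contraction i j : coprime i.+1 j.+1 -> (i < K)%N -> (j < K)%N ->
  0 < q i -> 0 < q j ->
  exists rho : R, [/\ 0 < rho, rho < 1 &
    forall f, exists2 D, 0 <= D & forall n m k l,
      (n <= m)%N -> (k < K)%N -> (l < K)%N ->
      `|iter n renew f k - iter m renew f l| <= D * rho ^+ n].
Proof.
move=> cij iK jK qi qj.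
have [N [eps [N0 eps0 eps2 doeblin]]] := renew_doeblin cij iK jK qi qj.
have NR : 1 <= N%:R :> R by rewrite ler1n.
have NR0 : 0 < N%:R :> R by rewrite ltr0n.
have epsN : 0 < eps / N%:R by rewrite divr_gt0.
have epsN1 : eps / N%:R <= 1 / 2.
  by apply: le_trans eps2; rewrite ler_pdivrMr// ler_peMr// ltW.
(* By Bernoulli's inequality [rho ^+ N >= 1 - eps], so the factor per block of [N] steps becomes a
   rate per step. *)
pose rho := 1 - eps / N%:R.
have rho0 : 0 < rho by rewrite /rho; lra.
have rho1 : rho < 1 by rewrite /rho; lra.
have rhoN : 1 - eps <= rho ^+ N.
  have := @bernoulli_ge _ (eps / N%:R) N.
  rewrite mulrCA divff ?mulr1 ?gt_eqF// => -> //; lra.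
have step f a b : (forall k, (k < K)%N -> a <= f k <= b) ->
    exists a' b', b' - a' <= (1 - eps) * (b - a) /\
      (forall k, (k < K)%N -> a' <= iter N renew f k <= b').
  move=> fab; exists (a + eps * (f 0%N - a)), (b - eps * (b - f 0%N)).
  split=> [|k kK]; first lra.
  apply/andP; split.
    have := @doeblin (fun x => 1 * f x + (- a)) _ k kK.
    rewrite iter_renew_affine => H.
    suff : eps * (1 * f 0%N - a) <= 1 * iter N renew f k - a by lra.
    by apply: H => l lK; case/andP: (fab l lK) => *; lra.
  have := @doeblin (fun x => (-1) * f x + b) _ k kK.
  rewrite iter_renew_affine => H.
  suff : eps * (-1 * f 0%N + b) <= -1 * iter N renew f k + b by lra.
  by apply: H => l lK; case/andP: (fab l lK) => *; lra.
exists rho; split=> // f.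
pose B := \sum_(k < K) `|f k|.
have fB k : (k < K)%N -> - B <= f k <= B.
  move=> kK; rewrite -ler_norml /B (bigD1 (Ordinal kK)) //= lerDl.
  exact: sumr_ge0.
have B0 : 0 <= B by exact: sumr_ge0.
(* Dividing by [rho ^+ N] covers the first [N] steps, for which only the trivial width [2 * B] is
   available. *)
pose D := 2 * B / rho ^+ N.
have D0 : 0 <= D by rewrite divr_ge0 ?mulr_ge0// exprn_ge0// ltW.
have osc n : exists a b, b - a <= D * rho ^+ n /\
    forall k, (k < K)%N -> a <= iter n renew f k <= b.
  elim/ltn_ind: n => n IH; have [nN|Nn] := ltnP n N.
    exists (- B), B; split; last exact: renew_bounds.
    have -> : B - - B = D * rho ^+ N.
      by rewrite /D divfK ?gt_eqF ?exprn_gt0//; lra.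
    apply: ler_wpM2l => //; apply: ler_wiXn2l; last exact: ltnW.
      exact: ltW.
    exact: ltW.
  have nNn : (n - N < n)%N by rewrite ltn_subrL N0 (leq_trans N0).
  have [a [b [ab Hab]]] := IH _ nNn.
  have [a' [b' [ab' Hab']]] := step _ _ _ Hab.
  exists a', b'; split; last by rewrite -iterD subnKC in Hab'.
  apply: le_trans ab' _; apply: le_trans (_ : (1 - eps) * (D * rho ^+ (n - N)) <= _).
    by apply: ler_wpM2l => //; lra.
  rewrite -[in leRHS](subnKC Nn) exprD [leRHS]mulrCA; apply: ler_wpM2r => //.
  by rewrite mulr_ge0// exprn_ge0// ltW.
exists D => // n m k l nm kK lK.
have [a [b [ab Hab]]] := osc n.
have := Hab k kK; have : a <= iter m renew f l <= b.
  by rewrite -(subnK nm) iterD; exact: renew_bounds.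
move=> /andP[? ?] /andP[? ?]; apply: le_trans ab; rewrite ler_norml.
by apply/andP; split; lra.
Qed.

End renewal_operator.

(** * Pairing of functions with service vectors *)

Section pairing.
Variables (R : realFieldType) (K : nat) (q : nat -> R).
Implicit Types f g x : nat -> R.

Definition pairing f x : R := \sum_(i < K) f i * x i.

Lemma pairing_addr f x y :
  pairing f (fun i => x i + y i) = pairing f x + pairing f y.
Proof. by rewrite -big_split; apply: eq_bigr => i _; rewrite mulrDr. Qed.

Lemma pairing_subl f g x :
  pairing (fun i => f i - g i) x = pairing f x - pairing g x.
Proof. by rewrite -sumrB; apply: eq_bigr => i _; rewrite mulrBl. Qed.

Lemma le_norm_pairing f x c :
  (forall i, (i < K)%N -> `|f i| <= c) ->
  `|pairing f x| <= c * \sum_(i < K) `|x i|.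
Proof.
move=> fc; apply: le_trans (ler_norm_sum _ _ _) _; rewrite mulr_sumr.
by apply: ler_sum => i _; rewrite normrM ler_wpM2r// fc.
Qed.

Lemma sum_shift x : x K = 0 -> \sum_(i < K) x i.+1 = \sum_(i < K) x i - x 0%N.
Proof.
move=> xK; apply/eqP; rewrite eq_sym subr_eq addrC; apply/eqP.
by rewrite -(big_ord_recl K (fun i : 'I_K.+1 => x i)) big_ord_recr /= xK addr0.
Qed.

(** [renew] is the transpose of the service dynamics, which shift [x] and redistribute its entry 0
    according to [q]. The condition [x K = 0] ensures that nothing is shifted in at the last
    index. *)
Lemma pairing_renew f x : x K = 0 ->
  pairing (renew K q f) x = pairing f (fun i => x i.+1 + x 0%N * q i).
Proof.
rewrite /pairing; case: K => [|k] xK; first by rewrite !big_ord0.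
rewrite big_ord_recl /=.
under [RHS]eq_bigr do rewrite mulrDr.
rewrite big_split /= addrC; congr (_ + _).
  by rewrite mulr_suml; apply: eq_bigr => i _; ring.
by rewrite [RHS]big_ord_recr /= xK mulr0 addr0.
Qed.

End pairing.

(** * Mean and variance under the service time weights *)

Section weighted_variance.
Variables (R : realFieldType) (K : nat) (q : nat -> R).
Hypothesis q_ge0 : forall i, 0 <= q i.
Hypothesis q_sum1 : \sum_(i < K) q i = 1.
Implicit Types f g : nat -> R.

Definition wmean f : R := \sum_(i < K) q i * f i.

Definition wvar f : R := wmean (fun i => f i ^+ 2) - wmean f ^+ 2.

Let wmeanD f g : wmean (fun i => f i + g i) = wmean f + wmean g.
Proof. by rewrite -big_split; apply: eq_bigr => i _; rewrite mulrDr. Qed.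

Let wmeanZ c f : wmean (fun i => c * f i) = c * wmean f.
Proof. by rewrite mulr_sumr; apply: eq_bigr => i _; rewrite mulrCA. Qed.

Let wmean_cst c : wmean (fun=> c) = c.
Proof. by rewrite /wmean -mulr_suml q_sum1 mul1r. Qed.

Let eq_wmean f g : (forall i, f i = g i) -> wmean f = wmean g.
Proof. by move=> fg; apply: eq_bigr => i _; rewrite fg. Qed.

Let le_norm_wmean f c : (forall i, (i < K)%N -> `|f i| <= c) -> `|wmean f| <= c.
Proof.
move=> fc; apply: le_trans (ler_norm_sum _ _ _) _.
rewrite -[leRHS]mul1r -q_sum1 mulr_suml; apply: ler_sum => i _.
by rewrite normrM ger0_norm// ler_wpM2l// fc.
Qed.

Lemma wvarE f c : wvar f = wmean (fun i => (f i - c) ^+ 2) - (wmean f - c) ^+ 2.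
Proof.
have -> : wmean (fun i => (f i - c) ^+ 2) =
    wmean (fun i => f i ^+ 2) + ((- (2 * c)) * wmean f + c ^+ 2).
  rewrite -(wmeanZ (- (2 * c))) -[X in _ + (_ + X)](wmean_cst (c ^+ 2)) -!wmeanD.
  by apply: eq_wmean => i; ring.
by rewrite /wvar; ring.
Qed.

Lemma wvar_ge0 f : 0 <= wvar f.
Proof.
rewrite (wvarE f (wmean f)) subrr expr0n subr0.
by apply: sumr_ge0 => i _; rewrite mulr_ge0// sqr_ge0.
Qed.

Lemma wvar_le g c G : (forall i, (i < K)%N -> `|g i - c| <= G) ->
  wvar g <= G ^+ 2.
Proof.
move=> gG; rewrite (wvarE g c) lerBlDr.
apply: le_trans (_ : G ^+ 2 <= _); last by rewrite lerDl sqr_ge0.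
apply: le_trans (ler_norm _) _; apply: le_norm_wmean => i iK.
by rewrite normrX; apply: lerXn2r; rewrite ?nnegrE ?gG// (le_trans _ (gG i iK)).
Qed.

(** The difference is [wvar g] minus twice the covariance of [f] and [g]; that covariance is
    [X - a * b], at most [2 * F * G] in absolute value. *)
Lemma wvarB_near f g c d F G : 0 <= F -> 0 <= G ->
  (forall i, (i < K)%N -> `|f i - c| <= F) ->
  (forall i, (i < K)%N -> `|g i - d| <= G) ->
  `|wvar (fun i => f i - g i) - wvar f| <= (4 * F + G) * G.
Proof.
move=> F0 G0 fF gG.
set X := wmean (fun i => (f i - c) * (g i - d)).
set a := wmean f - c; set b := wmean g - d.
have -> : wvar (fun i => f i - g i) - wvar f = wvar g - 2 * (X - a * b).
  have fgE : wmean (fun i => f i - g i) = wmean f - wmean g.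
    rewrite -[X in _ - X]mul1r -mulNr -wmeanZ -wmeanD.
    by apply: eq_wmean => i; ring.
  have -> : wvar (fun i => f i - g i) =
      wmean (fun i => (f i - c) ^+ 2) + (-2 * X + wmean (fun i => (g i - d) ^+ 2))
      - (a - b) ^+ 2.
    rewrite (wvarE _ (c - d)) fgE; congr (_ - _); last by rewrite /a /b; ring.
    by rewrite -wmeanZ -!wmeanD; apply: eq_wmean => i; ring.
  by rewrite (wvarE f c) (wvarE g d) -/a -/b; ring.
have X_le : `|X| <= F * G.
  by apply: le_norm_wmean => i iK; rewrite normrM ler_pM ?fF ?gG.
have mean_sub h e E : (forall i, (i < K)%N -> `|h i - e| <= E) ->
    `|wmean h - e| <= E.
  move=> hE; have -> : wmean h - e = wmean (fun i => h i + - e).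
    by rewrite wmeanD wmean_cst.
  exact: le_norm_wmean.
have ab_le : `|a * b| <= F * G by rewrite normrM ler_pM// mean_sub.
have := wvar_ge0 g; have := wvar_le gG.
move: X_le ab_le; rewrite !ler_norml => /andP[? ?] /andP[? ?] ? ?.
by apply/andP; split; lra.
Qed.

End weighted_variance.

Lemma sum_geom_le (R : realFieldType) (rho : R) n : 0 < rho -> rho < 1 ->
  \sum_(0 <= i < n) rho ^+ i <= (1 - rho)^-1.
Proof.
move=> r0 r1; have d0 : 0 < 1 - rho by lra.
suff : (1 - rho) * \sum_(0 <= i < n) rho ^+ i = 1 - rho ^+ n.
  move=> H; rewrite -[leRHS]mul1r ler_pdivlMr// mulrC H.
  by rewrite lerBlDr lerDl exprn_ge0// ltW.
elim: n => [|n IH]; first by rewrite big_geq// mulr0 expr0 subrr.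
by rewrite big_nat_recr//= mulrDr IH exprS; ring.
Qed.

Lemma sum_geom_rev_le (R : realFieldType) (rho : R) n : 0 < rho -> rho < 1 ->
  \sum_(0 <= i < n) rho ^+ (n - i.+1) <= (1 - rho)^-1.
Proof.
move=> r0 r1; apply: le_trans (sum_geom_le n r0 r1).
by rewrite [leRHS]big_nat_rev /= add0n.
Qed.

(** * Linear growth of the accumulated noise variance *)

Section variance_growth.
Variables (R : realFieldType) (K : nat) (q : nat -> R).
Hypothesis q_ge0 : forall i, 0 <= q i.
Hypothesis q_sum1 : \sum_(i < K) q i = 1.
Variables (w : nat -> nat -> R) (D rho : R).
Hypothesis D_ge0 : 0 <= D.
Hypotheses (rho_gt0 : 0 < rho) (rho_lt1 : rho < 1).
Hypothesis w_contract : forall n m k l,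
  (n <= m)%N -> (k < K)%N -> (l < K)%N -> `|w n k - w m l| <= D * rho ^+ n.

(** With [F = D] and [G = D * rho ^+ m <= D], the bound of [wvarB_near] is at most
    [C * rho ^+ m]. *)
Let C := 5 * D ^+ 2.

Let K_gt0 : (0 < K)%N.
Proof.
move: q_sum1; case: K => // /eqP.
by rewrite big_ord0 eq_sym oner_eq0.
Qed.

Let rhoX_le1 n : rho ^+ n <= 1.
Proof. by rewrite exprn_ile1// ltW. Qed.

Let rhoX_ge0 n : 0 <= rho ^+ n.
Proof. by rewrite exprn_ge0// ltW. Qed.

Let wvar_step n m :
  `|wvar K q (fun i => w n i - w m i) - wvar K q (w n)| <= C * rho ^+ m.
Proof.
apply: le_trans (@wvarB_near _ K q q_ge0 q_sum1 (w n) (w m) (w n 0%N) (w m 0%N)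
  D (D * rho ^+ m) _ _ _ _) _ => //.
- by rewrite mulr_ge0.
- move=> i iK; apply: le_trans (w_contract (leqnn n) iK K_gt0) _.
  by rewrite ler_piMr.
- by move=> i iK; exact: w_contract.
have -> : C * rho ^+ m = (4 * D + D) * (D * rho ^+ m) by rewrite /C; ring.
by rewrite ler_wpM2r ?mulr_ge0// lerD2l ler_piMr.
Qed.

Let wvar_small n : wvar K q (w n) <= C * rho ^+ n.
Proof.
apply: le_trans (@wvar_le _ K q q_ge0 q_sum1 (w n) (w n 0%N) (D * rho ^+ n) _) _.
  by move=> i iK; exact: w_contract.
have -> : (D * rho ^+ n) ^+ 2 = (D ^+ 2 * rho ^+ n) * rho ^+ n by ring.
rewrite ler_wpM2r//; apply: le_trans (_ : D ^+ 2 <= _).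
  by rewrite ler_piMr ?sqr_ge0.
by have := sqr_ge0 D; rewrite /C; lra.
Qed.

(** For [r >= s] the truncated difference [s - r.+1] is 0, and the term is the variance of [w 0] up
    to an error geometric in [t - r.+1]. For [r < s] the function [w (s - r.+1)] is itself nearly
    constant, so these terms have a bounded sum. *)
Lemma sum_wvar_le s t : (s <= t)%N ->
  \sum_(0 <= r < t) wvar K q (fun i => w (s - r.+1) i - w (t - r.+1) i)
    <= (t - s)%:R * wvar K q (w 0%N) + 2 * C / (1 - rho).
Proof.
move=> st.
apply: le_trans (_ : \sum_(0 <= r < t) (wvar K q (w (s - r.+1)) +
    C * rho ^+ (t - r.+1)) <= _).
  apply: ler_sum => r _; have := wvar_step (s - r.+1) (t - r.+1).
  by rewrite ler_norml => /andP[_]; lra.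
have C0 : 0 <= C by rewrite mulr_ge0// sqr_ge0.
rewrite big_split /= -mulr_sumr.
have -> : 2 * C / (1 - rho) = C / (1 - rho) + C / (1 - rho).
  by rewrite -mulrA mulr2n mulrDl mul1r.
rewrite addrA; apply: lerD; last first.
  by rewrite ler_wpM2l// sum_geom_rev_le.
rewrite (@big_cat_nat _ _ _ s) //= addrC; apply: lerD.
  rewrite big_seq_cond (eq_bigr (fun=> wvar K q (w 0%N))) -?big_seq_cond.
    by rewrite big_const_nat iter_addr_0 mulr_natl.
  move=> r; rewrite mem_index_iota andbT => /andP[sr _].
  by rewrite (_ : (s - r.+1 = 0)%N)//; apply/eqP; rewrite subn_eq0 leqW.
apply: le_trans (_ : \sum_(0 <= r < s) C * rho ^+ (s - r.+1) <= _).
  by apply: ler_sum => r _; exact: wvar_small.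
by rewrite -mulr_sumr ler_wpM2l// sum_geom_rev_le.
Qed.

Lemma sum_wvar_ge t :
  t%:R * wvar K q (w 0%N) - C / (1 - rho) <=
  \sum_(0 <= r < t) wvar K q (fun i => w 0%N i - w (t - r.+1) i).
Proof.
apply: le_trans (_ : \sum_(0 <= r < t) (wvar K q (w 0%N) -
    C * rho ^+ (t - r.+1)) <= _); last first.
  apply: ler_sum => r _; have := wvar_step 0 (t - r.+1).
  by rewrite ler_norml => /andP[+ _]; lra.
have C0 : 0 <= C by rewrite mulr_ge0// sqr_ge0.
rewrite sumrB -mulr_sumr big_const_nat iter_addr_0 subn0 mulr_natl.
by rewrite lerD2l lerN2 ler_wpM2l// sum_geom_rev_le.
Qed.

End variance_growth.

(** * Comparison with the always busy system *)

Section busy_process.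
Variables (R : realFieldType) (K : nat) (q : nat -> R) (beta : R).
Variables (l0 : nat -> R) (a : nat -> R) (j : nat -> nat -> R).

(* The service vector when freed capacity is refilled at once, so that the
   total stays equal to [beta] and the number entering service is [busy t 0]. *)
Fixpoint busy (t : nat) (i : nat) : R :=
  if t is t'.+1 then busy t' i.+1 + j t'.+1 i + busy t' 0%N * q i
  else l0 i + (beta - \sum_(k < K) l0 k) * q i.

Definition netput (t : nat) : R := \sum_(0 <= r < t) (a r.+1 - busy r 0%N).

Definition work (i : nat) : R := i.+1%:R.

Definition work_after n : nat -> R := iter n (renew K q) work.

Hypothesis q_sum1 : \sum_(i < K) q i = 1.
Hypothesis q_out : forall i, (K <= i)%N -> q i = 0.
Hypothesis l0_out : forall i, (K <= i)%N -> l0 i = 0.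
Hypothesis j_out : forall t i, (K <= i)%N -> j t i = 0.
Hypothesis j_sum0 : forall t, \sum_(i < K) j t.+1 i = 0.

Let m : R := \sum_(i < K) q i * work i.

Lemma busy_out t i : (K <= i)%N -> busy t i = 0.
Proof.
elim: t i => [|t IH] i Ki /=; first by rewrite l0_out// q_out// mulr0 addr0.
by rewrite IH ?leqW// j_out// q_out// mulr0 !addr0.
Qed.

Lemma pairing_busyS f t : pairing K f (busy t.+1) =
  pairing K (renew K q f) (busy t) + pairing K f (j t.+1).
Proof.
rewrite (pairing_renew _ _ (busy_out t (leqnn K))) -pairing_addr.
by apply: eq_bigr => i _ /=; ring.
Qed.

(** Variation of constants: the jump of time [r.+1] is carried to time [t] by [t - r.+1] steps,
    which transposition moves onto [f]. *)
Lemma pairing_busy f t : pairing K f (busy t) =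
  pairing K (iter t (renew K q) f) (busy 0) +
  \sum_(0 <= r < t) pairing K (iter (t - r.+1) (renew K q) f) (j r.+1).
Proof.
elim: t f => [|t IH] f; first by rewrite big_geq// addr0.
rewrite pairing_busyS IH big_nat_recr//= subnn -addrA -iterSr; congr (_ + _).
congr (_ + _); apply: eq_big_nat => r /andP[_ rt].
by rewrite -iterSr -subSn.
Qed.

Lemma busy_total t : \sum_(i < K) busy t i = beta.
Proof.
elim: t => [|t IH] /=.
  by rewrite big_split /= -mulr_sumr q_sum1 mulr1 addrC subrK.
rewrite !big_split /= -mulr_sumr q_sum1 mulr1 j_sum0 addr0.
by rewrite (sum_shift (busy_out t (leqnn K))) IH subrK.
Qed.

(** A Poisson equation: [renew K q work - work] is [m - 1] at index 0 and -1 elsewhere, so its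
    pairing with [busy t] is [m * busy t 0] minus the total [beta]. *)
Lemma mean_service_busy t : m * busy t 0%N =
  pairing K work (busy t.+1) - pairing K work (j t.+1) -
  pairing K work (busy t) + beta.
Proof.
have K0 : (0 < K)%N.
  by move: q_sum1; case: K => // /eqP; rewrite big_ord0 eq_sym oner_eq0.
rewrite pairing_busyS addrK -pairing_subl -[X in _ + X](busy_total t) -big_split /=.
rewrite (bigD1 (Ordinal K0)) //= [X in _ = _ + X]big1 ?addr0 => [|[[|i] iK] // _].
  by rewrite -/m /work; ring.
by rewrite /= /work -[i.+2%:R]natr1; ring.
Qed.

(** Summing [mean_service_busy] over [s <= r < t] telescopes to the pairings of [work] with [busy s]
    and [busy t], which [pairing_busy] expands into jumps and initial state. *)
Lemma netput_diff s t : (s <= t)%N ->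
  m * (netput t - netput s) =
    \sum_(0 <= r < t) (if (s <= r)%N then m * a r.+1 else 0) +
    \sum_(0 <= r < t) pairing K
      (fun i => work_after (s - r.+1) i - work_after (t - r.+1) i) (j r.+1) -
    beta * (t - s)%:R +
    pairing K (fun i => work_after s i - work_after t i) (busy 0).
Proof.
move=> st.
have -> : netput t - netput s = \sum_(s <= r < t) (a r.+1 - busy r 0%N).
  by rewrite /netput (@big_cat_nat _ _ _ s 0 t)//= addrAC subrr add0r.
have -> : m * \sum_(s <= r < t) (a r.+1 - busy r 0%N) =
    \sum_(s <= r < t) (m * a r.+1 + pairing K work (j r.+1) - beta) -
    (pairing K work (busy t) - pairing K work (busy s)).
  rewrite -(telescope_sumr (fun r => pairing K work (busy r)) st) -sumrB mulr_sumr.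
  by apply: eq_bigr => r _; rewrite mulrBr mean_service_busy; ring.
have splitA (F G : nat -> R) : \sum_(0 <= r < t) (if (s <= r)%N then F r else G r) =
    \sum_(0 <= r < s) G r + \sum_(s <= r < t) F r.
  rewrite (@big_cat_nat _ _ _ s)//=; congr (_ + _); apply: eq_big_nat => r.
    by move=> /andP[_]; rewrite ltnNge => /negbTE ->.
  by move=> /andP[->].
rewrite (splitA (fun r => m * a r.+1) (fun=> 0)) [\sum_(0 <= r < s) 0]big1 // add0r.
rewrite !(pairing_busy work).
(* Since [s - r.+1] is 0 for [r >= s], and [work_after 0] is [work], one formula covers the jumps
   before and after time [s]. *)
have -> : \sum_(0 <= r < t) pairing K
      (fun i => work_after (s - r.+1) i - work_after (t - r.+1) i) (j r.+1) =
    \sum_(0 <= r < s) pairing K (work_after (s - r.+1)) (j r.+1) +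
    \sum_(s <= r < t) pairing K work (j r.+1) -
    \sum_(0 <= r < t) pairing K (work_after (t - r.+1)) (j r.+1).
  rewrite -splitA -sumrB; apply: eq_bigr => r _; rewrite pairing_subl.
  congr (_ - _); case: ifP => // sr.
  by rewrite (_ : (s - r.+1 = 0)%N)//; apply/eqP; rewrite subn_eq0 leqW.
rewrite pairing_subl sumrB big_split /= sumr_const_nat.
by rewrite -[beta *+ _]mulr_natr /work_after; ring.
Qed.

(** * Pathwise comparison of the queue with the netput *)

Section comparison.
Variables (Q : nat -> R) (L : nat -> nat -> R).

Let ent t := Num.min (Q t + a t.+1) (beta - \sum_(i < K) L t i.+1).

Hypothesis q_ge0 : forall i, 0 <= q i.
Hypothesis L0 : forall i, L 0%N i = l0 i.
Hypothesis LS : forall t i, L t.+1 i = L t i.+1 + j t.+1 i + ent t * q i.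
Hypothesis QS : forall t,
  Q t.+1 = Num.max (Q t + a t.+1 + \sum_(i < K) L t i.+1 - beta) 0.
Hypothesis l0_le : \sum_(i < K) l0 i <= beta.

(** Initial free capacity plus the cumulative excess of entries into service in the always busy
    system over those in the chain. *)
Fixpoint lag t : R :=
  if t is t'.+1 then lag t' + (busy t' 0%N - ent t')
  else beta - \sum_(i < K) l0 i.

(* Cumulative excess of [busy] over [L]. *)
Fixpoint cumlag t i : R :=
  if t is t'.+1 then cumlag t' i.+1 + lag t'.+1 * q i else lag 0 * q i.

Let lag0_ge0 : 0 <= lag 0. Proof. by rewrite /= subr_ge0. Qed.

Let lag0E : lag 0 = beta - \sum_(i < K) l0 i. Proof. by []. Qed.

Let cumlag_out t i : (K <= i)%N -> cumlag t i = 0.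
Proof.
elim: t i => [|t IH] i Ki; first by rewrite /= q_out// mulr0.
by rewrite /= IH ?leqW// q_out// mulr0 addr0.
Qed.

(** The difference of the two service vectors obeys the shift recursion driven by the increments of
    [lag], hence is an increment of [cumlag]. *)
Let busy_subL t i : busy t i - L t i =
  cumlag t i - (if t is t'.+1 then cumlag t' i else 0).
Proof.
elim: t i => [|t IH] i; first by rewrite /= L0; ring.
rewrite /= LS.
have -> : busy t i.+1 + j t.+1 i + busy t 0%N * q i -
   (L t i.+1 + j t.+1 i + ent t * q i) =
   (busy t i.+1 - L t i.+1) + (busy t 0%N - ent t) * q i by ring.
by rewrite IH; case: t IH => [|t] IH /=; ring.
Qed.

Let total_LS t : \sum_(i < K) L t.+1 i =
  Num.min (Q t + a t.+1 + \sum_(i < K) L t i.+1) beta.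
Proof.
under eq_bigr do rewrite LS.
rewrite !big_split /= -mulr_sumr q_sum1 mulr1 j_sum0 addr0 addrC.
by rewrite addr_minl subrK.
Qed.

(** A renewal equation for [lag], forced by the idle capacity. When [busy_subL] at time [t.+1] is
    summed over the indices, the shift leaves only the entry [cumlag t 0]. *)
Let lagS t : lag t.+1 = beta - \sum_(i < K) L t.+1 i + cumlag t 0%N.
Proof.
rewrite -(busy_total t.+1) -sumrB.
under eq_bigr do rewrite busy_subL.
rewrite sumrB /= big_split /= -mulr_sumr q_sum1 mulr1.
by rewrite (sum_shift (cumlag_out t (leqnn K))); ring.
Qed.

Let queueE t : Q t = Q 0%N + netput t + lag t - lag 0.
Proof.
elim: t => [|t IH]; first by rewrite /netput big_geq//; ring.
have -> : Q t.+1 = Q t + a t.+1 - ent t.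
  rewrite QS /ent; set r := \sum_(i < K) _.
  by case: leP => ?; case: leP => ?; lra.
by rewrite IH /netput big_nat_recr//=; ring.
Qed.

(** The idle capacity is never negative, so the renewal equation keeps [lag] and [cumlag]
    nonnegative. *)
Lemma queue_ge t : Q 0%N - (beta - \sum_(i < K) l0 i) + netput t <= Q t.
Proof.
rewrite (queueE t) lag0E.
suff : 0 <= lag t by lra.
suff [] : 0 <= lag t /\ forall i, 0 <= cumlag t i by [].
elim: t => [|t [IHl IHc]].
  by split=> // i; apply: mulr_ge0.
have lS : 0 <= lag t.+1.
  rewrite lagS addr_ge0// subr_ge0 total_LS ge_min lexx orbT //.
by split=> // i; apply: addr_ge0 => //; apply: mulr_ge0.
Qed.

(** At full service the renewal equation expresses [lag] by its past with weights of sum at most 1,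
    so it cannot exceed an earlier bound. Otherwise the queue is empty and [queueE] gives [lag]
    exactly. The witness [s] is the last time at which the bound [e] rose. *)
Lemma queue_le t : Q t <= Q 0%N + netput t \/
  exists s, [/\ (0 < s)%N, (s <= t)%N & Q t <= netput t - netput s].
Proof.
(* [cumlag t i] sums past values of [lag] against the weights [q] from index [i] on, hence is at
   most their bound times [tail i]. *)
pose tail i := \sum_(i <= k < K) q k.
have tailE i : tail i = q i + tail i.+1.
  have [iK|Ki] := ltnP i K; first by rewrite /tail big_ltn.
  by rewrite /tail !big_geq ?q_out ?addr0// leqW.
have tail_ge0 i : 0 <= tail i by exact: sumr_ge0.
have tail0 : tail 0%N = 1 by rewrite /tail big_mkord.
have [e [eE [le_e e0 cum_e]]] : exists e,
    (e = lag 0 \/ exists s, [/\ (0 < s)%N, (s <= t)%N &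
       e = lag 0 - Q 0%N - netput s]) /\
    [/\ lag t <= e, 0 <= e & forall i, cumlag t i <= e * tail i].
  elim: t => [|t [e [eE [le_e e0 cum_e]]]].
    exists (lag 0); split; [by left|split=> // i].
    by apply: ler_wpM2l => //; rewrite tailE lerDl.
  (* By [queueE], the value of [lag t.+1] when the queue is empty at time [t.+1]. *)
  pose c := lag 0 - Q 0%N - netput t.+1.
  have lag_le : lag t.+1 <= Num.max e c.
    have [b_le|] := leP beta (Q t + a t.+1 + \sum_(i < K) L t i.+1).
      rewrite lagS total_LS min_r// subrr add0r le_max.
      by apply/orP; left; have := cum_e 0%N; rewrite tail0 mulr1.
    move=> b_gt; rewrite le_max; apply/orP; right.
    have Q0 : Q t.+1 = 0 by rewrite QS max_r// subr_le0 ltW.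
    by have := queueE t.+1; rewrite Q0 /c; lra.
  have e_le : e <= Num.max e c by rewrite le_max lexx.
  exists (Num.max e c); split.
    rewrite /Num.max; case: ifP => _; last first.
      case: eE => [|[s [s0 st ->]]]; [by left|right].
      by exists s; split=> //; exact: leqW.
    by right; exists t.+1.
  split=> // [|i]; first exact: le_trans e_le.
  rewrite /= tailE mulrDr addrC; apply: lerD.
    exact: ler_wpM2r.
  by apply: le_trans (cum_e _) _; exact: ler_wpM2r.
have := queueE t; case: eE => [eE|[s [s0 st eE]]] QE; [left|right].
  by rewrite QE; lra.
by exists s; split=> //; rewrite QE; lra.
Qed.

End comparison.

End busy_process.

(** * Independence and normal moment generating functions *)

Section image_density.
Context d d' (T : measurableType d) (T' : measurableType d') (R : realType).
Variables (mu : {measure set T -> \bar R}) (nu : {measure set T' -> \bar R}).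
Variables (X : T -> T') (g : T -> R).
Hypotheses (mX : measurable_fun setT X) (mg : measurable_fun setT g).
Hypothesis g_ge0 : forall x, 0 <= g x.
Hypothesis nuE : forall B, measurable B ->
  nu B = (\int[mu]_(x in X @^-1` B) (g x)%:E)%E.

Import HBNNSimple.
Local Open Scope ereal_scope.

(** Both sides pass to the limit along simple functions, and for indicators the identity is [nuE].
    It serves to split off one independent factor and to integrate against a normal density. *)
Lemma ge0_integral_image_density (f : T' -> \bar R) :
  measurable_fun setT f -> (forall y, 0 <= f y) ->
  \int[nu]_y f y = \int[mu]_x (f (X x) * (g x)%:E).
Proof.
move=> mf f0; pose h := nnsfun_approx measurableT mf.
have mgE : measurable_fun setT (EFin \o g) by exact/measurable_EFinP.
have hX n : measurable_fun setT ((EFin \o h n) \o X).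
  by apply: measurableT_comp => //; exact/measurable_EFinP.
transitivity (lim (\int[nu]_y (EFin \o h n) y @[n --> \oo])).
  rewrite -monotone_convergence//.
  - by apply: eq_integral => y _; apply/esym/cvg_lim => //; exact: cvg_nnsfun_approx.
  - by move=> n; exact/measurable_EFinP.
  - by move=> n y _; rewrite lee_fin.
  - by move=> y _ a b ab; rewrite lee_fin; exact/lefP/nd_nnsfun_approx.
transitivity (lim (\int[mu]_x ((EFin \o h n) (X x) * (g x)%:E) @[n --> \oo])); last first.
  rewrite -monotone_convergence//.
  - apply: eq_integral => x _; apply/cvg_lim => //; apply: cvgeZr => //.
    exact: cvg_nnsfun_approx.
  - by move=> n; apply: emeasurable_funM; [exact: hX|exact: mgE].
  - by move=> n x _; rewrite mule_ge0// lee_fin.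
  - move=> x _ a b ab; rewrite lee_wpmul2r ?lee_fin//.
    exact/lefP/nd_nnsfun_approx.
congr (lim (_ @ \oo)); apply/funext => n.
transitivity (\int[nu]_y (\sum_(r \in range (h n))
   (r * \1_(h n @^-1` [set r]) y)%:E)).
  by apply: eq_integral => y _; rewrite /= fimfunE -fsumEFin.
rewrite ge0_integral_fsum//; last 2 first.
  - by move=> r; apply/measurable_EFinP; exact: measurable_funM.
  - by move=> r y _; exact: nnfun_muleindic_ge0.
transitivity (\int[mu]_x (\sum_(r \in range (h n))
   ((r * \1_(h n @^-1` [set r]) (X x))%:E * (g x)%:E))); last first.
  apply: eq_integral => x _; rewrite -ge0_mule_fsuml => [|r].
    by rewrite /= fimfunE -fsumEFin.
  exact: nnfun_muleindic_ge0.
have mind r : measurable_fun setT (fun x => (r * \1_(h n @^-1` [set r]) (X x))%:E).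
  apply/measurable_EFinP; apply: measurable_funM => //.
  exact: measurableT_comp.
rewrite ge0_integral_fsum//; last 2 first.
  - by move=> r; exact: emeasurable_funM.
  - move=> r x _; apply: mule_ge0; first exact: nnfun_muleindic_ge0.
    by rewrite lee_fin.
apply: eq_fsbigr => r; rewrite inE => -[y _ <-].
set A := h n @^-1` _; have mA : measurable A by exact: measurable_funPTI.
have hy0 : (0 <= h n y)%R by [].
under eq_integral do rewrite EFinM.
rewrite ge0_integralZl_EFin//; last by exact/measurable_EFinP.
rewrite integral_indic// setIT nuE//.
under [RHS]eq_integral do rewrite EFinM -muleA.
rewrite ge0_integralZl_EFin//; last first.
- apply: emeasurable_funM => //; apply/measurable_EFinP.
  exact: measurableT_comp.
- by move=> x _; rewrite mule_ge0// lee_fin.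
rewrite integral_mkcond; congr (_ * _); apply: eq_integral => x _.
rewrite patchE indicE (_ : (x \in X @^-1` A) = (X x \in A)); last first.
  by apply/idP/idP; rewrite !inE.
by case: ifP => _; rewrite ?mul1e ?mul0e.
Qed.

End image_density.

(** * Expectation of a product of independent nonnegative variables *)

Section independence.
Context d (T : measurableType d) (R : realType) (P : probability T R).
Context {I : choiceType} (F : I -> set (set T)).
Hypothesis indF : mutually_independent P F.
Local Open Scope ereal_scope.

Variables (f : I -> T -> R) (m : I -> R).
Hypothesis f_ge0 : forall i w, (0 <= f i w)%R.
Hypothesis mf : forall i, measurable_fun setT (f i).
Hypothesis int_f : forall i, \int[P]_w (f i w)%:E = (m i)%:E.

Let m_ge0 i : (0 <= m i)%R.
Proof.
by rewrite -lee_fin -int_f; apply: integral_ge0 => w _; rewrite lee_fin.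
Qed.

(** Induction on the number of factors that are functions rather than indicators. With one more
    indicator, that of a preimage under [f h], the induction hypothesis says that a multiple of the
    law of [f h] is the image of the measure with density [g]. *)
Let integral_prod_indic (s1 s2 : seq I) (E : I -> set T) :
  (forall i B, i \in s1 -> measurable B -> F i (f i @^-1` B)) ->
  uniq (s1 ++ s2) ->
  (forall i, i \in s2 -> F i (E i)) ->
  (forall i, i \in s2 -> measurable (E i)) ->
  \int[P]_w (\prod_(i <- s1) f i w * \prod_(i <- s2) \1_(E i) w)%:E =
  (\prod_(i <- s1) m i * \prod_(i <- s2) fine (P (E i)))%:E.
Proof.
elim: s1 s2 E => [|h s1 IH] s2 E Ff; rewrite ?cat0s ?cat_cons.
  move=> us2 FE mE; rewrite big_nil mul1r.
  have mI : measurable (\bigcap_(i in [set` s2]) E i).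
    by apply: fin_bigcap_measurable => //; exact: finite_seq.
  transitivity (P (\bigcap_(i in [set` s2]) E i)); last first.
    rewrite indF// -prodEFin; apply: eq_big_seq => i is2.
    by rewrite fineK// fin_num_measure//; exact: mE.
  rewrite -[X in P X]setIT -integral_indic//; apply: eq_integral => w _.
  rewrite big_nil mul1r; congr (_%:E).
  rewrite [RHS]indicE; have [|/negP nE] := boolP (w \in _).
    rewrite inE => Ew; rewrite big_seq big1// => i is2.
    by rewrite indicE mem_set//; exact: Ew.
  have [i is2 nEi] : exists2 i, i \in s2 & ~ E i w.
    apply: contrapT => H; apply: nE; rewrite inE => i is2.
    by apply: contrapT => nEi; apply: H; exists i.
  apply/eqP; rewrite prodf_seq_eq0; apply/hasP; exists i => //=.
  by rewrite indicE memNset.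
move=> /= /andP[hns us] FE mE.
have hs1 : h \notin s1 by apply: contra hns; rewrite mem_cat => ->.
have hs2 : h \notin s2 by apply: contra hns; rewrite mem_cat orbC => ->.
have Ff1 i B : i \in s1 -> measurable B -> F i (f i @^-1` B).
  by move=> is1; apply: Ff; rewrite inE is1 orbT.
pose g w := (\prod_(i <- s1) f i w * \prod_(i <- s2) \1_(E i) w)%R.
have mg : measurable_fun setT g.
  apply: measurable_funM; first by apply: measurable_prod => i _; exact: mf.
  by apply: measurable_prod => i is2; apply: measurable_indic; exact: mE.
have g0 w : (0 <= g w)%R.
  by apply: mulr_ge0; apply: prodr_ge0 => i _.
pose c := (\prod_(i <- s1) m i * \prod_(i <- s2) fine (P (E i)))%R.
have c0 : (0 <= c)%R.
  by apply: mulr_ge0; apply: prodr_ge0 => i _ //; exact: fine_ge0.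
have mfh := mf h.
pose X : {RV P >-> R} := HB.pack (f h) (isMeasurableFun.Build _ _ _ _ _ mfh).
pose nu := mscale (NngNum c0) (distribution P X).
have nuE B : measurable B -> nu B = \int[P]_(w in f h @^-1` B) (g w)%:E.
  move=> mB; have mfB : measurable (f h @^-1` B).
    by rewrite -[_ @^-1` _]setTI; exact: mf.
  pose E' i := if i == h then f h @^-1` B else E i.
  have E's2 i : i \in s2 -> E' i = E i.
    by move=> is2; rewrite /E' ifN//; apply: contraNneq hs2 => <-.
  have := IH (h :: s2) E' Ff1.
  have -> : uniq (s1 ++ h :: s2).
    by rewrite uniq_catC /= mem_cat negb_or hs1 hs2 /= uniq_catC.
  move=> /(_ isT).
  have FE' i : i \in h :: s2 -> F i (E' i).
    rewrite inE => /predU1P[->|is2]; last by rewrite E's2//; exact: FE.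
    by rewrite /E' eqxx; apply: Ff => //; rewrite mem_head.
  have mE' i : i \in h :: s2 -> measurable (E' i).
    by rewrite inE /E'; case: eqP => //= _; exact: mE.
  move=> /(_ FE' mE').
  rewrite /nu /mscale /= /distribution /pushforward /= big_cons {2}/E' eqxx.
  have -> : (\prod_(i <- s2) fine (P (E' i)) = \prod_(i <- s2) fine (P (E i)))%R.
    by apply: eq_big_seq => i is2; rewrite E's2.
  rewrite mulrCA EFinM fineK ?fin_num_measure// muleC => <-.
  rewrite [RHS]integral_mkcond; apply: eq_integral => w _.
  rewrite patchE big_cons.
  have -> : (\prod_(i <- s2) \1_(E' i) w = \prod_(i <- s2) \1_(E i) w :> R)%R.
    by apply: eq_big_seq => i is2; rewrite E's2.
  by rewrite /E' eqxx indicE; case: ifP => _; rewrite ?mul1r ?mul0r ?mulr0.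
(* The test function must be nonnegative on all of [R]; the absolute value agrees with the identity
   on the values of [f h]. *)
have mabs : measurable_fun setT (fun y : R => `|y|%:E).
  by apply/measurable_EFinP; exact: normr_measurable.
have abs0 (y : R) : 0 <= `|y|%:E by rewrite lee_fin.
have := ge0_integral_image_density mfh mg g0 nuE mabs abs0.
rewrite ge0_integral_mscale// ge0_integral_distribution//.
have -> : \int[P]_x ((fun y : R => `|y|%:E) \o X) x = (m h)%:E.
  by rewrite -int_f; apply: eq_integral => w _; rewrite /= ger0_norm.
rewrite big_cons -mulrA [X in _ -> _ = X]EFinM muleC => ->; apply: eq_integral => w _.
by rewrite big_cons -mulrA EFinM ger0_norm.
Qed.

Lemma integral_prod_independent (s : seq I) : uniq s ->
  (forall i B, i \in s -> measurable B -> F i (f i @^-1` B)) ->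
  \int[P]_w (\prod_(i <- s) f i w)%:E = (\prod_(i <- s) m i)%:E.
Proof.
move=> us Ff; have := @integral_prod_indic s [::] (fun=> setT) Ff.
rewrite cats0 big_nil mulr1 => /(_ us) <-//.
by apply: eq_integral => w _; rewrite big_nil mulr1.
Qed.

End independence.

(** * Exponential moments of centered normal variables *)

Section normal_mgf.
Context {R : realType}.

Let mexpRM (c : R) : measurable_fun setT (fun x : R => (expR (c * x))%:E).
Proof.
by apply/measurable_EFinP; apply: measurableT_comp.
Qed.

(** Completing the square: [expR (c * x)] turns the density of mean 0 into that of mean
    [c * s ^+ 2], up to the constant on the right. *)
Let integral_normal_pdf_expR (s c : R) : s != 0 ->
  (\int[lebesgue_measure]_x ((expR (c * x))%:E * (normal_pdf 0 s x)%:E) =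
   (expR (c ^+ 2 * s ^+ 2 / 2))%:E)%E.
Proof.
move=> s0; transitivity (\int[lebesgue_measure]_x
    ((expR (c ^+ 2 * s ^+ 2 / 2))%:E * (normal_pdf (c * s ^+ 2) s x)%:E))%E.
  apply: eq_integral => x _; rewrite -!EFinM; congr (_%:E).
  rewrite !normal_pdfE// /normal_fun [LHS]mulrCA [RHS]mulrCA; congr (_ * _).
  rewrite -!expRD; congr expR.
  have s20 : s ^+ 2 != 0 by rewrite expf_neq0.
  by field.
rewrite ge0_integralZl_EFin ?expR_ge0//; last 2 first.
- by move=> x _; rewrite lee_fin normal_pdf_ge0.
- by apply/measurable_EFinP; exact: measurable_normal_pdf.
by rewrite integral_normal_pdf mule1.
Qed.

Lemma centered_normal_expR d (T : measurableType d) (P : probability T R)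
    (v c : R) (X : T -> R) :
  0 <= v -> measurable_fun setT X -> is_centered_normal P v X ->
  (\int[P]_w (expR (c * X w))%:E = (expR (c ^+ 2 * v / 2))%:E)%E.
Proof.
move=> v0 mX; rewrite /is_centered_normal /centered_normal => nX.
pose Y : {RV P >-> R} := HB.pack X (isMeasurableFun.Build _ _ _ _ _ mX).
transitivity (\int[distribution P Y]_x (expR (c * x))%:E)%E.
  by rewrite ge0_integral_distribution.
have [vz|vn] := eqVneq v 0.
  rewrite (@eq_measure_integral _ _ _ _ (\d_(0 : R))).
    by rewrite integral_dirac//= diracT mul1e vz !mulr0 mul0r.
  by move=> A mA _; rewrite -[LHS]/(P (X @^-1` A)) nX// vz eqxx.
have s0 : Num.sqrt v != 0 by rewrite sqrtr_eq0 -ltNge lt_neqAle eq_sym vn.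
(* The Lebesgue measure lives on another measurable structure on [R], with the
   same measurable sets; [id] goes from the one to the other. *)
rewrite (@ge0_integral_image_density _ _ _ _ R lebesgue_measure
  (distribution P Y) id (normal_pdf 0 (Num.sqrt v)))//; last 3 first.
- exact: measurable_normal_pdf.
- by move=> x; exact: normal_pdf_ge0.
- by move=> B mB; rewrite -[LHS]/(P (X @^-1` B)) nX// (negbTE vn).
by rewrite integral_normal_pdf_expR// sqr_sqrtr.
Qed.

End normal_mgf.

(** * The limiting chain *)

Section service_time_facts.
Context {R : realType} {d : measure_display} {T : measurableType d}
        {P : probability T R} (S : {RV P >-> nat}) (K : nat).
Hypothesis S_range : forall w : T, (1 <= S w <= K)%N.

Let q i := service_pmf S i.+1.

Let mS k : measurable (S @^-1` [set k]).
Proof. exact: measurable_funPTI. Qed.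

Lemma service_pmf_ge0 k : 0 <= service_pmf S k.
Proof. exact: fine_ge0. Qed.

Lemma service_pmf_out k : (k == 0)%N || (K < k)%N -> service_pmf S k = 0.
Proof.
move=> k_out; rewrite /service_pmf (_ : S @^-1` [set k] = set0) ?measure0//.
apply/seteqP; split=> // w /= Sw; move: (S_range w); rewrite Sw.
by case/orP: k_out => [/eqP->//|]; rewrite ltnNge => /negbTE ->; rewrite andbF.
Qed.

Lemma integral_service (phi : nat -> R) : (forall k, 0 <= phi k) ->
  (\int[P]_w (phi (S w))%:E = (\sum_(i < K) q i * phi i.+1)%:E)%E.
Proof.
move=> phi0.
transitivity (\int[P]_w (\sum_(i <- index_enum 'I_K)
    (phi i.+1 * \1_(S @^-1` [set i.+1]) w)%:E))%E.
  apply: eq_integral => w _; rewrite sumEFin; congr (_%:E).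
  have /andP[S1 SK] := S_range w; have SK' : ((S w).-1 < K)%N by rewrite prednK.
  rewrite (bigD1 (Ordinal SK')) //= big1 ?addr0.
    by rewrite prednK// indicE mem_set ?mulr1.
  move=> i; rewrite -val_eqE /= => Si; rewrite indicE memNset ?mulr0//=.
  by move=> Sw; rewrite Sw /= eqxx in Si.
rewrite ge0_integral_sum//; last 2 first.
- move=> i; apply/measurable_EFinP; apply: measurable_funM => //.
- by move=> i w _; rewrite lee_fin mulr_ge0// indicE.
rewrite -sumEFin; apply: eq_bigr => i _.
under eq_integral do rewrite EFinM.
rewrite ge0_integralZl_EFin//; last by apply/measurable_EFinP.
rewrite integral_indic// setIT muleC EFinM /q /service_pmf fineK//.
exact: fin_num_measure.
Qed.

Lemma service_pmf_sum1 : \sum_(i < K) q i = 1.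
Proof.
have := @integral_service (fun=> 1) (fun=> ler01).
have -> : (\int[P]_w (1 : R)%:E = 1)%E.
  by have := expectation_cst P 1; rewrite unlock.
by move=> [->]; apply: eq_bigr => i _; rewrite mulr1.
Qed.

Lemma service_mean :
  fine ('E_P[fun w => (S w)%:R])%E = \sum_(i < K) q i * work R i.
Proof.
rewrite unlock (@integral_service (fun k => k%:R))//.
Qed.

Lemma service_varE : service_var S = wvar K q (work R).
Proof.
rewrite /service_var /variance covariance.unlock service_mean.
set m := \sum_(i < K) _; rewrite unlock.
under eq_integral do rewrite /= -expr2.
rewrite (integral_service (fun k => sqr_ge0 (k%:R - m))).
by rewrite (wvarE service_pmf_sum1 _ m) subrr expr0n subr0.
Qed.

End service_time_facts.

(** * Convolutions with geometric weights *)

Lemma exists_expr_le {R : realType} (x e : R) : 0 <= x -> x < 1 -> 0 < e ->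
  exists n : nat, forall m, (n <= m)%N -> x ^+ m <= e.
Proof.
move=> x0 x1 e0; have x_cvg : (fun n => x ^+ n) @ \oo --> (0 : R).
  by apply: cvg_expr; rewrite ger0_norm.
move/cvgrPdist_le : x_cvg => /(_ _ e0)[n _ Hn].
exists n => m nm; apply: le_trans (Hn m nm).
by rewrite sub0r normrN ler_norm.
Qed.

(** Only the terms with [s < s0] can be large; a [t] far beyond [s0] makes their weights so small
    that they contribute at most 1. The resulting bound involves neither [C] nor [s0]. *)
Lemma geometric_window {R : realType} (x e C : R) (b : nat -> R) (s0 : nat) :
  0 < x -> x < 1 -> 0 <= e -> (forall s, 0 <= b s <= C) ->
  (forall s, (s0 <= s)%N -> b s <= e) ->
  exists t : nat, \sum_(0 <= s < t.+1) b s * x ^+ (t - s) <= 1 + e / (1 - x).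
Proof.
move=> x0 x1 e0 bC be; have d0 : 0 < 1 - x by lra.
have xX n : 0 <= x ^+ n by rewrite exprn_ge0// ltW.
have C0 : 0 <= C by case/andP: (bC 0%N); exact: le_trans.
have s0C : 0 <= s0%:R * C by exact: mulr_ge0.
have e1 : 0 < (s0%:R * C + 1)^-1 by rewrite invr_gt0; lra.
have [n Hn] := exists_expr_le (ltW x0) x1 e1.
exists (s0 + n)%N.
rewrite (@big_cat_nat _ _ _ s0) ?leqW ?leq_addr//=; apply: lerD.
  apply: le_trans (_ : \sum_(0 <= s < s0) C * (s0%:R * C + 1)^-1 <= _).
    rewrite big_seq [leRHS]big_seq; apply: ler_sum => s.
    rewrite mem_index_iota => /andP[_ ss0].
    case/andP: (bC s) => b0 bsC; apply: ler_pM => //; apply: Hn.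
    by rewrite -addnBAC ?leq_addl// ltnW.
  rewrite big_const_nat iter_addr_0 subn0 -[leLHS]mulr_natl mulrA.
  by rewrite ler_pdivrMr ?mul1r; lra.
rewrite -{1}[s0]add0n big_addn.
apply: le_trans (_ : \sum_(0 <= s < n.+1) e * x ^+ (n.+1 - s.+1) <= _).
  rewrite subSn ?leq_addr// addKn big_seq [leRHS]big_seq; apply: ler_sum => s _.
  rewrite [(s0 + n)%N]addnC subnDr subSS; apply: ler_wpM2r => //.
  by apply: be; exact: leq_addl.
by rewrite -mulr_sumr; apply: ler_wpM2l => //; exact: sum_geom_rev_le.
Qed.

(** * Tuples and matrices of the model in terms of sequences *)

Lemma remainingE {R : realType} (K : nat) (l : K.-tuple R) :
  remaining l = \sum_(i < K) nth 0 l i.+1.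
Proof.
rewrite (sum_shift (x := fun i => nth 0 l i)); last by rewrite nth_default ?size_tuple.
rewrite /remaining; case: K l => [|K] l.
  by rewrite !big_ord0 (tuple0 l) subr0.
rewrite [in RHS]big_ord_recl addrC addKr big_mkcond big_ord_recl /= add0r.
by apply: eq_bigr => i _; rewrite (tnth_nth 0).
Qed.

Lemma totalE {R : realType} (K : nat) (l : K.-tuple R) :
  Defs.total l = \sum_(i < K) nth 0 l i.
Proof. by apply: eq_bigr => i _; rewrite (tnth_nth 0). Qed.

Lemma nth_next_service {R : realType} (K : nat) (p : nat -> R) (beta q a : R)
    (l j : K.-tuple R) (i : nat) :
  (forall i, (K <= i)%N -> p i.+1 = 0) ->
  nth 0 (next_service p beta q l a j) i =
  nth 0 l i.+1 + nth 0 j i + entering beta q l a * p i.+1.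
Proof.
move=> p0; have [iK|Ki] := ltnP i K.
  rewrite -[i]/(val (Ordinal iK)) -tnth_nth tnth_mktuple tnth_mktuple.
  by rewrite -tnth_nth.
by rewrite !nth_default ?size_tuple ?p0 ?mulr0 ?addr0// leqW.
Qed.

(** The multinomial covariance is that of the indicators of the possible service times, so its
    quadratic form at [f] is the variance of [f] under [p]. *)
Lemma multinomial_cov_quad {R : realType} (K : nat) (p f : nat -> R) (c : R) :
  ((\row_(i < K) f i) *m (c *: multinomial_cov p) *m (\row_(i < K) f i)^T) 0 0 =
  c * wvar K (fun i => p i.+1) f.
Proof.
rewrite -scalemxAr -scalemxAl mxE; congr (c * _).
rewrite mxE /wvar /wmean expr2 mulr_suml -sumrB; apply: eq_bigr => k _.
rewrite !mxE.
have -> : \sum_j (\row_i f i) 0 j * multinomial_cov p j k =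
    p k.+1 * f k - p k.+1 * \sum_(i < K) p i.+1 * f i.
  rewrite (eq_bigr (fun i : 'I_K => (if i == k then p k.+1 * f k else 0) -
      p k.+1 * (p i.+1 * f i))); last first.
    move=> i _; rewrite !mxE; case: eqVneq => [->|_]; ring.
  by rewrite sumrB -big_mkcond /= big_pred1_eq mulr_sumr.
by ring.
Qed.

Lemma measurable_nth_tuple {R : realType} (K i : nat) :
  measurable_fun setT (fun l : K.-tuple R => nth 0 l i).
Proof.
have [iK|Ki] := ltnP i K.
  rewrite (_ : (fun _ => _) = (fun l : K.-tuple R => tnth l (Ordinal iK))).
    exact: measurable_tnth.
  by apply/funext => l; rewrite (tnth_nth 0).
rewrite (_ : (fun _ => _) = cst 0); first exact: measurable_cst.
by apply/funext => l; rewrite nth_default ?size_tuple.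
Qed.

Lemma measurable_pairing {R : realType} (K : nat) (f : nat -> R) :
  measurable_fun setT (fun l : K.-tuple R => pairing K f (fun i => nth 0 l i)).
Proof.
apply: measurable_sum => i; apply: measurable_funM => //.
exact: measurable_nth_tuple.
Qed.

Lemma sigma_of_comp {R : realType} d d' (T : measurableType d)
    (T' : measurableType d') (X : T -> T') (h : T' -> R) (B : set R) :
  measurable_fun setT h -> measurable B -> sigma_of X ((h \o X) @^-1` B).
Proof.
move=> mh mB; exists (h @^-1` B); last by rewrite setTI comp_preimage.
by rewrite -[_ @^-1` _]setTI; exact: mh.
Qed.

(** * Exponential moments of the chain *)

Section limit_chain_bounds.
Context {R : realType} (K : nat) (p : nat -> R) (mu ca beta : R).
Local Notation q := (fun i : nat => p i.+1).
Hypothesis p_ge0 : forall i, 0 <= p i.+1.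
Hypothesis p_sum1 : \sum_(i < K) p i.+1 = 1.
Hypothesis p_out : forall i, (K <= i)%N -> p i.+1 = 0.
Hypothesis mu_gt0 : 0 < mu.
Hypothesis mu_mean : mu * \sum_(i < K) p i.+1 * work R i = 1.

Context {d : measure_display} {T : measurableType d} {P : probability T R}.
Variables (Q : nat -> {RV P >-> R}) (L : nat -> {RV P >-> K.-tuple R})
          (A : nat -> {RV P >-> R}) (J : nat -> {RV P >-> K.-tuple R}).
Hypothesis chain : is_limit_chain p mu ca beta Q L A J.

Local Notation l0 w := (fun i => nth 0 (L 0%N w) i).
Local Notation arr w := (fun t => A t w).
Local Notation jmp w := (fun t i => nth 0 (J t w) i).
Local Notation W := (work_after K q).

(** The random part of [theta] times the netput between [s] and [t], see [net_noise]. Jumps before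
    [s] contribute too, through the state at time [s]. *)
Definition noise (theta : R) (s t : nat) (w : T) : R :=
  \sum_(0 <= r < t) (if (s <= r)%N then theta * A r.+1 w else 0) +
  \sum_(0 <= r < t) theta * mu *
    pairing K (fun i => W (s - r.+1) i - W (t - r.+1) i) (jmp w r.+1).

Definition noise_var (theta : R) (s t : nat) : R :=
  \sum_(0 <= r < t) (if (s <= r)%N then theta ^+ 2 * (mu * ca ^+ 2) else 0) +
  \sum_(0 <= r < t) (theta * mu) ^+ 2 *
    (mu * wvar K q (fun i => W (s - r.+1) i - W (t - r.+1) i)).

Let jump_normal (f : nat -> R) t :
  is_centered_normal P (mu * wvar K q f) (fun w => pairing K f (jmp w t)).
Proof.
have [_ HJ _ _ _] := chain; have := HJ t (\row_(i < K) f i).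
rewrite multinomial_cov_quad.
rewrite (_ : (fun w => \sum_(i < K) _) = (fun w => pairing K f (jmp w t)))//.
by apply/funext => w; apply: eq_bigr => i _; rewrite mxE (tnth_nth 0).
Qed.

Let measurable_jump (f : nat -> R) t :
  measurable_fun setT (fun w => pairing K f (jmp w t)).
Proof.
exact: (measurableT_comp (measurable_pairing f) (measurable_funPT (J t))).
Qed.

(** The vector of ones is in the kernel of the multinomial covariance, so the sum of the entries has
    variance 0 and its law is the point mass at 0. *)
Lemma jump_sum0_ae :
  {ae P, forall w, forall t, \sum_(i < K) nth 0 (J t.+1 w) i = 0}.
Proof.
apply/ae_foralln => t.
pose X w := pairing K (fun=> 1) (jmp w t.+1).
have mX : measurable_fun setT X by exact: measurable_jump.
have mN : measurable (X @^-1` [set~ 0]).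
  by rewrite -[_ @^-1` _]setTI; apply: mX => //; exact: measurableC.
have := jump_normal (fun=> 1) t.+1.
have -> : mu * wvar K q (fun=> 1) = 0.
  apply/eqP; rewrite mulf_eq0; apply/orP; right; apply/eqP.
  rewrite /wvar /wmean expr1n; under eq_bigr do rewrite mulr1.
  by rewrite p_sum1 expr1n subrr.
move=> /(_ [set~ 0] (measurableC (measurable_set1 _))).
rewrite /centered_normal eqxx -/(X @^-1` _) diracE memNset ?mulr0n//; last first.
  by move=> /(_ erefl).
move=> X0; exists (X @^-1` [set~ 0]); split => // w /=.
move=> H Xw; apply: H; transitivity (X w) => //; apply: eq_bigr => i _.
by rewrite mul1r.
Qed.

(** The noise is a sum of independent normal variables, also independent of the initial state, so
    the expectation factors into normal moment generating functions. *)
Lemma integral_noise (theta : R) (s t : nat) (B : set (R * K.-tuple R)) :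
  0 <= ca -> measurable B ->
  (\int[P]_w (\1_B (Q 0%N w, L 0%N w) * expR (noise theta s t w))%:E =
   (fine (P ((fun w => (Q 0%N w, L 0%N w)) @^-1` B)) *
    expR (noise_var theta s t / 2))%:E)%E.
Proof.
move=> ca0 mB.
have [HA HJ HI _ _] := chain.
(* The noise variables carry the index [r.+1], so the condition [s <= r] of [noise] becomes a strict
   one. *)
pose c r := if (s < r)%N then theta else 0.
pose g r i := W (s - r) i - W (t - r) i.
pose f (i : option (nat + nat)) (w : T) : R := match i with
  | None => \1_B (Q 0%N w, L 0%N w)
  | Some (inl r) => expR (c r * A r w)
  | Some (inr r) => expR (theta * mu * pairing K (g r) (jmp w r))
  end.
pose m (i : option (nat + nat)) : R := match i with
  | None => fine (P ((fun w => (Q 0%N w, L 0%N w)) @^-1` B))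
  | Some (inl r) => expR (c r ^+ 2 * (mu * ca ^+ 2) / 2)
  | Some (inr r) => expR ((theta * mu) ^+ 2 * (mu * wvar K q (g r)) / 2)
  end.
have mX0 : measurable_fun setT (fun w => (Q 0%N w, L 0%N w)).
  by apply: measurable_fun_pair; exact: measurable_funPT.
have f0 i w : 0 <= f i w.
  by case: i => [[r|r]|]; rewrite /= ?expR_ge0// indicE.
have mf i : measurable_fun setT (f i).
  case: i => [[r|r]|] /=.
  - by apply: measurableT_comp => //; exact: measurable_funM.
  - by apply: measurableT_comp => //; exact: measurable_funM.
  - exact: (measurableT_comp (measurable_indic mB) mX0).
have int_f i : (\int[P]_w (f i w)%:E = (m i)%:E)%E.
  case: i => [[r|r]|] /=.
  - by apply: centered_normal_expR => //; rewrite mulr_ge0 ?sqr_ge0// ltW.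
  - apply: (centered_normal_expR _ _ (measurable_jump (g r) r)) => //.
    by rewrite mulr_ge0 ?wvar_ge0// ltW.
  - have mB' : measurable ((fun w => (Q 0%N w, L 0%N w)) @^-1` B).
      by rewrite -[_ @^-1` _]setTI; exact: mX0.
    by rewrite fineK ?fin_num_measure// -[X in P X]setIT -integral_indic.
have Ff i C : measurable C ->
  match i with
  | None => sigma_of (fun w => (Q 0%N w, L 0%N w))
  | Some (inl t) => sigma_of (A t)
  | Some (inr t) => sigma_of (J t)
  end (f i @^-1` C).
  move=> mC; case: i => [[r|r]|] /=.
  - apply: (@sigma_of_comp _ _ _ _ _ (A r) (fun x => expR (c r * x))) => //.
    by apply: measurableT_comp => //; exact: measurable_funM.
  - apply: (@sigma_of_comp _ _ _ _ _ (J r)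
      (fun l => expR (theta * mu * pairing K (g r) (fun i => nth 0 l i)))) => //.
    apply: measurableT_comp => //; apply: measurable_funM => //.
    exact: measurable_pairing.
  - exact: (@sigma_of_comp _ _ _ _ _ _ \1_B).
pose idx := None :: [seq Some (inl r.+1) | r <- iota 0 t] ++
  [seq Some (inr r.+1) | r <- iota 0 t] : seq (option (nat + nat)).
have uidx : uniq idx.
  rewrite /= mem_cat negb_or cat_uniq; apply/andP; split.
    by apply/andP; split; apply/mapP => -[].
  apply/and3P; split.
  - by rewrite map_inj_uniq ?iota_uniq// => a b [].
  - by apply/hasPn => _ /mapP[r _ ->]; apply/mapP => -[].
  - by rewrite map_inj_uniq ?iota_uniq// => a b [].
have := integral_prod_independent HI f0 mf int_f uidx (fun i C _ => @Ff i C).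
have prodE (F : option (nat + nat) -> R) : \prod_(i <- idx) F i =
    F None * (\prod_(0 <= r < t) F (Some (inl r.+1)) *
              \prod_(0 <= r < t) F (Some (inr r.+1))).
  by rewrite big_cons big_cat !big_map /index_iota subn0.
rewrite prodE /= -!expR_sum -expRD => H.
have -> : noise_var theta s t / 2 =
    \sum_(0 <= r < t) c r.+1 ^+ 2 * (mu * ca ^+ 2) / 2 +
    \sum_(0 <= r < t) (theta * mu) ^+ 2 * (mu * wvar K q (g r.+1)) / 2.
  rewrite /noise_var mulrDl !mulr_suml; congr (_ + _); apply: eq_bigr => r _.
  by rewrite /c ltnS; case: ifP => _ //; rewrite expr0n /= !mul0r.
rewrite -H; apply: eq_integral => w _; congr (_%:E).
rewrite prodE /= -!expR_sum -expRD; congr (_ * expR (_ + _)).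
by apply: eq_bigr => r _; rewrite /c ltnS; case: ifP => _ //; rewrite mul0r.
Qed.

Lemma measurable_noise (theta : R) (s t : nat) :
  measurable_fun setT (noise theta s t).
Proof.
apply: measurable_funD; apply: measurable_sum => r.
  by case: (s <= r)%N; [exact: measurable_funM|exact: measurable_cst].
by apply: measurable_funM => //; exact: measurable_jump.
Qed.

Let net w t := netput K q beta (l0 w) (arr w) (jmp w) t.
Let start w i := busy K q beta (l0 w) (jmp w) 0 i.
Let v := wvar K q (work R).

Hypothesis beta_gt0 : 0 < beta.
Hypothesis ca_ge0 : 0 <= ca.
Variables (D rho : R).
Hypothesis D_ge0 : 0 <= D.
Hypotheses (rho_gt0 : 0 < rho) (rho_lt1 : rho < 1).
Hypothesis W_contract : forall n m k l,
  (n <= m)%N -> (k < K)%N -> (l < K)%N -> `|W n k - W m l| <= D * rho ^+ n.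

Definition init_norm (x : R * K.-tuple R) : R :=
  `|x.1| + \sum_(i < K) `|nth 0 x.2 i|.

Let init w := (Q 0%N w, L 0%N w).

Definition init_ball (M : R) : set (R * K.-tuple R) := [set x | init_norm x <= M].

Let l0_out w i : (K <= i)%N -> nth 0 (L 0%N w) i = 0.
Proof. by move=> Ki; rewrite nth_default// size_tuple. Qed.

Let jmp_out w t i : (K <= i)%N -> nth 0 (J t w) i = 0.
Proof. by move=> Ki; rewrite nth_default// size_tuple. Qed.

(** This is [netput_diff] multiplied by [theta * mu], as [mu] times the mean service time is 1. *)
Lemma net_noise theta s t w : (s <= t)%N ->
  (forall t, \sum_(i < K) nth 0 (J t.+1 w) i = 0) ->
  theta * (net w t - net w s) =
  noise theta s t w - theta * mu * beta * (t - s)%:R +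
  theta * mu * pairing K (fun i => W s i - W t i) (start w).
Proof.
move=> st jsum0.
have := @netput_diff _ K q beta (l0 w) (arr w) (jmp w) p_sum1 p_out
  (l0_out w) (jmp_out w) jsum0 _ _ st.
rewrite -/(net w) -/(start w) => H.
have -> : theta * (net w t - net w s) = theta * mu *
    ((\sum_(i < K) p i.+1 * work R i) * (net w t - net w s)).
  by rewrite mulrA -(mulrA theta) mu_mean mulr1.
rewrite H /noise !mulrDr mulrN -!addrA; congr (_ + _).
  rewrite mulr_sumr; apply: eq_bigr => r _; case: ifP => _; last by rewrite mulr0.
  by rewrite mulrA -(mulrA theta) mu_mean mulr1.
by rewrite mulr_sumr !mulrA.
Qed.

(** Refilling the free capacity at time 0 adds at most [beta + M] to the norm of the initial service
    vector. *)
Lemma start_norm M w : init_ball M (init w) ->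
  \sum_(i < K) `|start w i| <= 2 * M + beta.
Proof.
rewrite /init_ball /= /init_norm /= => lM.
set l := \sum_(i < K) _ in lM.
have lM' : l <= M by apply: le_trans lM; rewrite lerDr.
have abs_sum : `|\sum_(i < K) nth 0 (L 0%N w) i| <= M.
  by apply: le_trans lM'; exact: ler_norm_sum.
apply: le_trans (_ : \sum_(i < K) (`|nth 0 (L 0%N w) i| +
    `|beta - \sum_(i < K) nth 0 (L 0%N w) i| * p i.+1) <= _).
  apply: ler_sum => i _; rewrite /start /=; apply: le_trans (ler_normD _ _) _.
  by rewrite normrM [`|p _|]ger0_norm.
rewrite big_split /= -mulr_sumr p_sum1 mulr1 -/l.
have := ler_normB beta (\sum_(i < K) nth 0 (L 0%N w) i).
by rewrite [`|beta|]gtr0_norm//; lra.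
Qed.

Lemma drift_le M s t w : (s <= t)%N -> init_ball M (init w) ->
  `|pairing K (fun i => W s i - W t i) (start w)| <= D * rho ^+ s * (2 * M + beta).
Proof.
move=> st wM; apply: le_trans (@le_norm_pairing _ K _ _ (D * rho ^+ s) _) _.
  by move=> i iK; exact: W_contract.
by apply: ler_wpM2l (start_norm wM); rewrite mulr_ge0// exprn_ge0// ltW.
Qed.

Let var_err theta : R := (theta * mu) ^+ 2 * mu * (2 * (5 * D ^+ 2) / (1 - rho)).

(** Variance of the noise per step, up to bounded errors; [ca ^+ 2 + mu ^+ 2 * v] is the sum of the
    squared coefficients of variation. *)
Let rate theta : R := theta ^+ 2 * mu * (ca ^+ 2 + mu ^+ 2 * v).

Let sum_if (c : R) s t : (s <= t)%N ->
  \sum_(0 <= r < t) (if (s <= r)%N then c else 0) = (t - s)%:R * c.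
Proof.
move=> st; rewrite (@big_cat_nat _ _ _ s)//= big_nat_cond big1 ?add0r; last first.
  by move=> r /andP[/andP[_ +] _]; rewrite ltnNge => /negbTE ->.
rewrite (eq_big_nat _ _ (F2 := fun=> c)); last by move=> r /andP[-> _].
by rewrite big_const_nat iter_addr_0 mulr_natl.
Qed.

Lemma noise_var_le theta s t : (s <= t)%N ->
  noise_var theta s t <= (t - s)%:R * rate theta + var_err theta.
Proof.
move=> st; rewrite /noise_var sum_if//.
have := sum_wvar_le p_ge0 p_sum1 D_ge0 rho_gt0 rho_lt1 W_contract st.
set S := \sum_(0 <= r < t) _ => H.
have -> : \sum_(0 <= r < t) (theta * mu) ^+ 2 *
    (mu * wvar K q (fun i => W (s - r.+1) i - W (t - r.+1) i)) =
    (theta * mu) ^+ 2 * mu * S.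
  by rewrite mulr_sumr; apply: eq_bigr => r _; rewrite mulrA.
have c0 : 0 <= (theta * mu) ^+ 2 * mu by rewrite mulr_ge0 ?sqr_ge0// ltW.
have := ler_wpM2l c0 H; rewrite /rate /var_err /v -/(W 0%N).
by rewrite mulrDr; move: (_ * (2 * _ / _)) => e; lra.
Qed.

Lemma noise_var_ge theta t :
  t%:R * rate theta - var_err theta <= noise_var theta 0 t.
Proof.
rewrite /noise_var (sum_if _ (leq0n t)) subn0.
have := sum_wvar_ge p_ge0 p_sum1 D_ge0 rho_gt0 rho_lt1 W_contract t.
set S := \sum_(0 <= r < t) _ => H.
have -> : \sum_(0 <= r < t) (theta * mu) ^+ 2 *
    (mu * wvar K q (fun i => W (0 - r.+1) i - W (t - r.+1) i)) =
    (theta * mu) ^+ 2 * mu * S.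
  by rewrite mulr_sumr; apply: eq_bigr => r _; rewrite mulrA.
have c0 : 0 <= (theta * mu) ^+ 2 * mu by rewrite mulr_ge0 ?sqr_ge0// ltW.
have := ler_wpM2l c0 H; rewrite /rate /var_err /v -/(W 0%N).
have e0 : 0 <= 5 * D ^+ 2 / (1 - rho).
  by rewrite divr_ge0 ?mulr_ge0 ?sqr_ge0// subr_ge0 ltW.
have := mulr_ge0 c0 e0; set c := (theta * mu) ^+ 2 * mu.
have -> : 2 * (5 * D ^+ 2) / (1 - rho) = 2 * (5 * D ^+ 2 / (1 - rho)).
  by rewrite [RHS]mulrA.
by set e := 5 * D ^+ 2 / (1 - rho); rewrite /c; nra.
Qed.

Let measurable_init_norm : measurable_fun setT init_norm.
Proof.
apply: measurable_funD; first exact: measurableT_comp.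
apply: measurable_sum => i; apply: measurableT_comp => //.
exact: (measurableT_comp (measurable_nth_tuple i) measurable_snd).
Qed.

Let measurable_ball M : measurable (init_ball M).
Proof.
rewrite (_ : init_ball M = init_norm @^-1` `]-oo, M]).
  by rewrite -[_ @^-1` _]setTI; exact: measurable_init_norm.
by apply/seteqP; split=> x; rewrite /init_ball /= in_itv.
Qed.

Let measurable_init : measurable_fun setT init.
Proof. by apply: measurable_fun_pair; exact: measurable_funPT. Qed.

Let measurable_init_ball M : measurable (init @^-1` init_ball M).
Proof. by rewrite -[_ @^-1` _]setTI; exact: measurable_init. Qed.

Lemma init_ball_tight eps : 0 < eps ->
  exists2 M, 0 <= M & 1 - eps <= fine (P (init @^-1` init_ball M)).
Proof.
move=> eps0.
pose F n := init @^-1` init_ball n%:R.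
have mF n : measurable (F n) by exact: measurable_init_ball.
have ndF : nondecreasing_seq F.
  move=> a b ab; apply/subsetPset => w; rewrite /F /init_ball /= => H.
  by apply: le_trans H _; rewrite ler_nat.
have UF : \bigcup_n F n = setT.
  apply/seteqP; split=> // w _.
  have [n Hn] : exists n : nat, init_norm (init w) <= n%:R.
    by exists (Num.trunc (init_norm (init w))).+1; rewrite ltW// truncnS_gt.
  by exists n.
have PF : (P \o F) @ \oo --> 1%:E.
  rewrite -(probability_setT P) -UF.
  by apply: nondecreasing_cvg_mu => //; exact: bigcup_measurable.
have fF : (fine \o (P \o F)) @ \oo --> (1 : R) by apply: fine_cvg.
move/cvgrPdist_le : fF => /(_ _ eps0)[n _ /(_ n (leqnn n))] /= Hn.
exists n%:R => //; move: Hn; rewrite ler_norml => /andP[_]; rewrite -/(F n).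
by lra.
Qed.

(** An almost sure event on which the pathwise comparison applies. *)
Let good w := (forall t, \sum_(i < K) nth 0 (J t.+1 w) i = 0) /\
  \sum_(i < K) nth 0 (L 0%N w) i <= beta.

Let good_ae : {ae P, forall w, good w}.
Proof.
have [_ _ _ init_ae _] := chain.
apply: filterS2 (jump_sum0_ae) init_ae => w j0 [l_le _].
by split=> //; rewrite -totalE.
Qed.

Let next_nth t w i : nth 0 (L t.+1 w) i = nth 0 (L t w) i.+1 + nth 0 (J t.+1 w) i +
  Num.min (Q t w + A t.+1 w) (beta - \sum_(i < K) nth 0 (L t w) i.+1) * p i.+1.
Proof.
have [_ _ _ _ HS] := chain; have [_ ->] := HS t w.
by rewrite nth_next_service// /entering remainingE.
Qed.

Let nextQ t w : Q t.+1 w =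
  Num.max (Q t w + A t.+1 w + \sum_(i < K) nth 0 (L t w) i.+1 - beta) 0.
Proof.
have [_ _ _ _ HS] := chain; have [-> _] := HS t w.
by rewrite /next_queue remainingE.
Qed.

Let chain_ge t w : good w ->
  Q 0%N w - (beta - \sum_(i < K) nth 0 (L 0%N w) i) + net w t <= Q t w.
Proof.
move=> [j0 l_le].
exact: (@queue_ge _ K q beta (l0 w) (arr w) (jmp w) p_sum1 p_out (l0_out w)
  (jmp_out w) j0 (fun t => Q t w) (fun t i => nth 0 (L t w) i) p_ge0
  (fun=> erefl) (fun t i => next_nth t w i) (fun t => nextQ t w) l_le).
Qed.

Let chain_le t w : good w -> Q t w <= Q 0%N w + net w t \/
  exists s, [/\ (0 < s)%N, (s <= t)%N & Q t w <= net w t - net w s].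
Proof.
move=> [j0 l_le].
exact: (@queue_le _ K q beta (l0 w) (arr w) (jmp w) p_sum1 p_out (l0_out w)
  (jmp_out w) j0 (fun t => Q t w) (fun t i => nth 0 (L t w) i) p_ge0
  (fun=> erefl) (fun t i => next_nth t w i) (fun t => nextQ t w) l_le).
Qed.

Let shift_le theta M s t w : 0 < theta -> (s <= t)%N -> init_ball M (init w) ->
  `|theta * mu * pairing K (fun i => W s i - W t i) (start w)| <=
  theta * mu * (D * (2 * M + beta)) * rho ^+ s.
Proof.
move=> th0 st wM; have th_mu : 0 <= theta * mu by rewrite mulr_ge0// ltW.
rewrite normrM (ger0_norm th_mu) -[leRHS]mulrA; apply: ler_wpM2l => //.
by have := drift_le st wM; rewrite mulrAC.
Qed.

Let Q0_le M w : init_ball M (init w) -> `|Q 0%N w| <= M.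
Proof. by apply: le_trans; rewrite lerDl sumr_ge0. Qed.

Let l0_le M w : init_ball M (init w) -> \sum_(i < K) `|nth 0 (L 0%N w) i| <= M.
Proof. by apply: le_trans; rewrite lerDr. Qed.

Let int_ball M theta s t :
  (\int[P]_w (\1_(init_ball M) (init w) * expR (noise theta s t w))%:E =
   (fine (P (init @^-1` init_ball M)) * expR (noise_var theta s t / 2))%:E)%E.
Proof. exact: (integral_noise theta s t ca_ge0 (measurable_ball M)). Qed.

Let measurable_ball_noise M theta s t : measurable_fun setT
  (fun w => \1_(init_ball M) (init w) * expR (noise theta s t w)).
Proof.
apply: measurable_funM.
  exact: (measurableT_comp (measurable_indic (measurable_ball M)) measurable_init).
by apply: measurableT_comp => //; exact: measurable_noise.
Qed.

Let ball_prob_le1 M : fine (P (init @^-1` init_ball M)) <= 1.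
Proof.
rewrite -lee_fin fineK ?fin_num_measure//; exact: probability_le1.
Qed.

(** On a ball of initial states of probability at least 1/2, the queue at time [t] is at least the
    netput minus a constant. Here the variance outweighs the drift, so the exponential moment of the
    netput on that ball grows at least like [expR (gam * t)]. *)
Lemma mgf_unbounded theta : 0 < theta ->
  2 * beta < theta * (ca ^+ 2 + mu ^+ 2 * v) ->
  forall y : R, exists t, (y%:E <= \int[P]_w (expR (theta * Q t w))%:E)%E.
Proof.
move=> th0 th_gt y.
have [M M0 HM] := @init_ball_tight (1 / 2) ltac:(lra).
set pM := fine _ in HM.
have th_mu : 0 < theta * mu by exact: mulr_gt0.
pose gam := rate theta / 2 - theta * mu * beta.
have gam0 : 0 < gam.
  have -> : gam = theta * mu * ((theta * (ca ^+ 2 + mu ^+ 2 * v) - 2 * beta) / 2).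
    by rewrite /gam /rate; field.
  by apply: mulr_gt0 => //; lra.
pose kap := theta * mu * (D * (2 * M + beta)).
(* The losses: [theta * (2 * M + beta)] from the initial queue and free capacity, [kap] from the
   last term of [net_noise], [var_err] from the variance, and 1/2 from the ball. *)
pose c := expR (- (theta * (2 * M + beta)) - kap - var_err theta / 2) / 2.
have c0 : 0 < c by rewrite divr_gt0// expR_gt0.
(* A linear lower bound suffices to choose [t], as the exponential of [z] is at least [1 + z]. *)
pose t := (Num.trunc (`|y| / (c * gam))).+1.
have t_ge : y <= c * (1 + gam * t%:R).
  have cg : 0 < c * gam by exact: mulr_gt0.
  have : `|y| / (c * gam) < t%:R by exact: truncnS_gt.
  rewrite ltr_pdivrMr// => H; have := ler_norm y; nra.
exists t.
pose k := expR (- (theta * (2 * M + beta)) - kap - theta * mu * beta * t%:R).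
have k0 : 0 < k by exact: expR_gt0.
apply: (@le_trans _ _ (\int[P]_w (k * (\1_(init_ball M) (init w) *
    expR (noise theta 0 t w)))%:E)%E); last first.
  apply: ae_ge0_le_integral => //.
  - move=> w _; rewrite lee_fin; apply: mulr_ge0; first exact: ltW.
    by rewrite mulr_ge0 ?expR_ge0// indicE.
  - by apply/measurable_EFinP; apply: measurable_funM.
  - apply/measurable_EFinP; apply: measurableT_comp => //.
    by apply: measurable_funM => //; exact: measurable_funPT.
  apply: filterS good_ae => w gw _; rewrite lee_fin indicE.
  case: (boolP (_ \in _)) => [|_]; last by rewrite mul0r mulr0 expR_ge0.
  rewrite inE => wM; rewrite mul1r -expRD ler_expR.
  have := chain_ge t gw; have [j0 _] := gw.
  have := net_noise theta (leq0n t) j0; rewrite subn0.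
  have -> : net w 0 = 0 by rewrite /net /netput big_geq.
  rewrite subr0 => netE Qt.
  have := shift_le th0 (leq0n t) wM; rewrite expr0 mulr1 -/kap ler_norml => /andP[sh _].
  have := Q0_le wM; rewrite ler_norml => /andP[q0 _].
  have := le_trans (ler_norm_sum _ _ _) (l0_le wM); rewrite ler_norml => /andP[l0M _].
  have : theta * (- (2 * M + beta) + net w t) <= theta * Q t w.
    by apply: ler_wpM2l; [exact: ltW|apply: le_trans Qt; lra].
  by rewrite mulrDr netE mulrN; lra.
under eq_integral do rewrite EFinM.
rewrite ge0_integralZl_EFin ?(ltW k0)//; last exact/measurable_EFinP.
rewrite int_ball -EFinM lee_fin -/pM; apply: le_trans t_ge _.
apply: le_trans (_ : c * expR (gam * t%:R) <= _).
  by rewrite ler_pM2l//; exact: expR_ge1Dx.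
have := noise_var_ge theta t => nv.
apply: le_trans (_ : k * (1 / 2 * expR ((t%:R * rate theta - var_err theta) / 2)) <= _).
  have -> : k * (1 / 2 * expR ((t%:R * rate theta - var_err theta) / 2)) =
     expR (- (theta * (2 * M + beta)) - kap - theta * mu * beta * t%:R +
      (t%:R * rate theta - var_err theta) / 2) / 2.
    by rewrite expRD /k; ring.
  have -> : c * expR (gam * t%:R) = expR (- (theta * (2 * M + beta)) - kap -
      var_err theta / 2 + gam * t%:R) / 2 by rewrite expRD /c; ring.
  by rewrite ler_pM2r ?invr_gt0// ler_expR /gam; lra.
apply: ler_wpM2l; first exact: ltW.
apply: ler_pM; rewrite ?expR_ge0//.
  by apply: le_trans HM; lra.
by rewrite ler_expR; lra.
Qed.

(** The alternatives of [queue_le] are bounded by a sum over [s], whose terms have expectations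
    geometric in [t - s]. Truncation controls the initial states outside a ball; [t] is chosen after
    that ball, so [C] does not depend on [B]. *)
Lemma truncated_mgf_bounded theta : 0 < theta ->
  theta * (ca ^+ 2 + mu ^+ 2 * v) < 2 * beta ->
  exists C : R, forall B, 0 <= B -> exists t,
    (\int[P]_w (Num.min (expR (theta * Q t w)) B)%:E <= C%:E)%E.
Proof.
move=> th0 th_lt.
have th_mu : 0 < theta * mu by exact: mulr_gt0.
pose gam := theta * mu * beta - rate theta / 2.
have gam0 : 0 < gam.
  have -> : gam = theta * mu * ((2 * beta - theta * (ca ^+ 2 + mu ^+ 2 * v)) / 2).
    by rewrite /gam /rate; field.
  by apply: mulr_gt0 => //; lra.
pose x := expR (- gam).
have x0 : 0 < x by exact: expR_gt0.
have x1 : x < 1 by rewrite expR_lt1 oppr_lt0.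
pose E := expR (var_err theta / 2).
(* The first 1 comes from outside the ball, [E] from the variance error, and the inner sum from
   [geometric_window] with eventual bound [expR 1]. *)
exists (1 + E * (1 + expR 1 / (1 - x))) => B B0.
(* The probability allowed outside the ball; [B] times it is at most 1. *)
have B1 : 0 < (B + 1)^-1 by rewrite invr_gt0; lra.
have [M M0 HM] := init_ball_tight B1.
set pM := fine _ in HM.
pose kap := theta * mu * (D * (2 * M + beta)).
have kap0 : 0 <= kap.
  apply: mulr_ge0 (ltW th_mu) _; apply: mulr_ge0 D_ge0 _.
  by rewrite addr_ge0 ?mulr_ge0 ?(ltW beta_gt0).
(* The cost of the initial state in the term [s]: the initial queue when [s = 0], and the fading
   memory of the service vector. *)
pose b s := expR ((if s == 0%N then theta * M else 0) + kap * rho ^+ s).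
have thM : 0 <= theta * M by rewrite mulr_ge0// ltW.
have bC s : 0 <= b s <= expR (theta * M + kap).
  rewrite expR_ge0 /= ler_expR; apply: lerD; first by case: ifP.
  by rewrite ler_piMr// exprn_ile1// ltW.
have kap1 : 0 < (kap + 1)^-1 by rewrite invr_gt0; lra.
have [n Hn] := exists_expr_le (ltW rho_gt0) rho_lt1 kap1.
have be s : (n.+1 <= s)%N -> b s <= expR 1.
  move=> ns; rewrite ler_expR ifF; last by case: s ns.
  rewrite add0r; apply: le_trans (_ : kap * (kap + 1)^-1 <= _).
    by apply: ler_wpM2l => //; apply: Hn; exact: ltnW.
  by rewrite ler_pdivrMr; lra.
have [t Ht] := geometric_window x0 x1 (expR_ge0 1) bC be.
exists t.
pose k s := b s * expR (- (theta * mu * beta * (t - s)%:R)).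
have k0 s : 0 <= k s by rewrite mulr_ge0 ?expR_ge0.
pose h s w := \1_(init_ball M) (init w) * expR (noise theta s t w).
have h0 s w : 0 <= h s w by rewrite mulr_ge0 ?expR_ge0// indicE.
have mh s : measurable_fun setT (h s) by exact: measurable_ball_noise.
pose O w := B * \1_(~` init_ball M) (init w).
have O0 w : 0 <= O w by rewrite mulr_ge0// indicE.
have mOI : measurable_fun setT (fun w => \1_(~` init_ball M) (init w) : R).
  apply: (measurableT_comp (measurable_indic _) measurable_init).
  exact: measurableC (measurable_ball M).
have mO : measurable_fun setT O by exact: measurable_funM.
have pointwise w : good w ->
    Num.min (expR (theta * Q t w)) B <= O w + \sum_(0 <= s < t.+1) k s * h s w.
  move=> gw; have sum0 : 0 <= \sum_(0 <= s < t.+1) k s * h s w.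
    by apply: sumr_ge0 => s _; exact: mulr_ge0.
  have [wM|wM] := pselect (init_ball M (init w)); last first.
    rewrite ge_min; apply/orP; right.
    by rewrite /O indicE mem_set// mulr1 lerDl.
  rewrite ge_min; apply/orP; left.
  suff Hs : expR (theta * Q t w) <= \sum_(0 <= s < t.+1) k s * h s w.
    by apply: le_trans Hs _; rewrite lerDr.
  (* The value [s = 0] stands for the first alternative of [chain_le], where the initial queue still
     counts. *)
  have [s [st Qs]] : exists s, (s <= t)%N /\
      theta * Q t w <= (if s == 0%N then theta * M else 0) +
                       theta * (net w t - net w s).
    have [Qt|[s [s0 st Qt]]] := chain_le t gw.
      exists 0%N; split=> //=.
      have -> : net w 0 = 0 by rewrite /net /netput big_geq.
      rewrite subr0 -mulrDr; apply: ler_wpM2l; first exact: ltW.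
      apply: le_trans Qt _; rewrite lerD2r.
      exact: le_trans (ler_norm _) (Q0_le wM).
    exists s; split=> //; rewrite ifF; last by case: s s0 {st Qt}.
    by rewrite add0r; apply: ler_wpM2l => //; exact: ltW.
  have us : uniq (index_iota 0 t.+1) by exact: iota_uniq.
  rewrite (bigD1_seq s _ us) ?mem_index_iota ?ltnS//=.
  apply: le_trans (_ : k s * h s w <= _); last first.
    by rewrite lerDl; apply: sumr_ge0 => r _; exact: mulr_ge0.
  rewrite /k /b /h indicE mem_set// mul1r -!expRD ler_expR.
  apply: le_trans Qs _; have [j0 _] := gw; rewrite (net_noise theta st j0).
  have := shift_le th0 st wM; rewrite -/kap ler_norml => /andP[_].
  lra.
have int_h s : (s <= t)%N -> (\int[P]_w (k s * h s w)%:E <=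
    (b s * x ^+ (t - s) * E)%:E)%E.
  move=> st; under eq_integral do rewrite EFinM.
  rewrite ge0_integralZl_EFin//;
    [|by move=> w _; rewrite lee_fin|exact/measurable_EFinP].
  rewrite int_ball -EFinM lee_fin /k -[leRHS]mulrA -[leLHS]mulrA.
  apply: ler_wpM2l; first exact: expR_ge0.
  apply: le_trans (_ : expR (- (theta * mu * beta * (t - s)%:R)) *
      (1 * expR (noise_var theta s t / 2)) <= _).
    apply: ler_wpM2l; first exact: expR_ge0.
    by apply: ler_wpM2r; [exact: expR_ge0|exact: ball_prob_le1].
  rewrite mul1r -expRD /E /x -expRM_natl -expRD ler_expR.
  have := noise_var_le theta st; rewrite /gam; lra.
have int_O : (\int[P]_w (O w)%:E <= 1%:E)%E.
  under eq_integral do rewrite EFinM.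
  rewrite ge0_integralZl_EFin//; last exact/measurable_EFinP.
  have -> : (\int[P]_w (\1_(~` init_ball M) (init w))%:E = (1 - pM)%:E)%E.
    rewrite EFinB /pM fineK ?fin_num_measure// -probability_setC//.
    by rewrite -[X in P X]setIT -integral_indic//; exact: measurableC.
  rewrite -EFinM lee_fin; apply: le_trans (_ : B * (B + 1)^-1 <= _).
    by apply: ler_wpM2l => //; lra.
  by rewrite ler_pdivrMr; lra.
pose g w := O w + \sum_(0 <= s < t.+1) k s * h s w.
have mkh : forall r, measurable_fun setT (fun w => k r * h r w).
  by move=> r; exact: measurable_funM.
have g0 w : 0 <= g w.
  by apply: addr_ge0 => //; apply: sumr_ge0 => r _; exact: mulr_ge0.
have mg : measurable_fun setT g.
  by apply: measurable_funD => //; apply: measurable_sum.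
apply: (@le_trans _ _ (\int[P]_w (g w)%:E)%E).
  apply: ae_ge0_le_integral => //.
  - by move=> w _; rewrite lee_fin le_min expR_ge0 B0.
  - apply/measurable_EFinP; apply: measurable_minr => //.
    apply: measurableT_comp => //; apply: measurable_funM => //.
  - by move=> w _; rewrite lee_fin.
  - exact/measurable_EFinP.
  by apply: filterS good_ae => w gw _; rewrite lee_fin pointwise.
under eq_integral do rewrite EFinD -sumEFin.
rewrite ge0_integralD//; last 4 first.
- by move=> w _; rewrite lee_fin.
- exact/measurable_EFinP.
- by move=> w _; apply: sume_ge0 => r _; rewrite lee_fin mulr_ge0.
- by apply: emeasurable_sum => r; exact/measurable_EFinP.
rewrite ge0_integral_sum//; last 2 first.
- by move=> r; exact/measurable_EFinP.
- by move=> r w _; rewrite lee_fin mulr_ge0.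
rewrite EFinD; apply: leeD => //.
apply: (@le_trans _ _ (\sum_(0 <= s < t.+1) (b s * x ^+ (t - s) * E)%:E)%E).
  rewrite big_seq [leRHS]big_seq; apply: lee_sum => r.
  by rewrite mem_index_iota ltnS => /andP[_]; exact: int_h.
rewrite sumEFin lee_fin -mulr_suml mulrC; apply: ler_wpM2l => //.
exact: expR_ge0.
Qed.

End limit_chain_bounds.

(** * Passage to the stationary law *)

Section stationary_law.
Context {R : realType} {d d' : measure_display} {T : measurableType d}
        {T' : measurableType d'} {P : probability T R}.
Variables (X : T -> T') (pi : probability T' R).
Hypothesis mX : measurable_fun setT X.
Hypothesis X_law : forall B, measurable B -> P (X @^-1` B) = pi B.
Local Open Scope ereal_scope.

Lemma integral_law (f : T' -> \bar R) :
  measurable_fun setT f -> (forall x, 0 <= f x) ->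
  \int[pi]_x f x = \int[P]_w f (X w).
Proof.
move=> mf f0.
pose Y : {RV P >-> T'} := HB.pack X (isMeasurableFun.Build _ _ _ _ _ mX).
rewrite -[RHS](ge0_integral_distribution Y mf f0).
by apply: eq_measure_integral => B mB _; exact/esym/X_law.
Qed.

End stationary_law.

(** Monotone convergence along integer levels. Bounding each truncation separately lets the time at
    which the chain is observed depend on the level. *)
Lemma integral_le_of_truncations {R : realType} d (T : measurableType d)
    (pi : {measure set T -> \bar R}) (f : T -> R) (C : R) :
  measurable_fun setT f -> (forall x, 0 <= f x) ->
  (forall B : R, 0 <= B -> (\int[pi]_x (Num.min (f x) B)%:E <= C%:E)%E) ->
  (\int[pi]_x (f x)%:E <= C%:E)%E.
Proof.
move=> mf f0 fC.
pose g n x := (Num.min (f x) n%:R)%:E.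
have g_cvg x : g ^~ x @ \oo --> (f x)%:E.
  apply: cvg_near_cst; exists (Num.trunc (f x)).+1 => // n /= fn.
  by rewrite /g min_l// ltW// (lt_le_trans (truncnS_gt _))// ler_nat.
have g_nd x : nondecreasing_seq (g ^~ x).
  by move=> a b ab; rewrite lee_fin le_min2 // ler_nat.
have -> : (\int[pi]_x (f x)%:E = \int[pi]_x (limn (g ^~ x)))%E.
  by apply: eq_integral => x _; rewrite (cvg_lim _ (g_cvg x)).
have mg n : measurable_fun setT (g n).
  by apply/measurable_EFinP; exact: measurable_minr.
have g0 n x : setT x -> (0 <= g n x)%E by rewrite lee_fin le_min f0 ler0n.
rewrite monotone_convergence//; apply: lime_le.
  apply: ereal_nondecreasing_is_cvgn => a b ab; apply: ge0_le_integral => //.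
    by move=> x; exact: g0.
  by move=> x _; exact: (g_nd x _ _ ab).
by apply: nearW => n; exact: fC.
Qed.

Theorem theorem2 (R : realType) (K : nat)
  (d : measure_display) (T : measurableType d) (P : probability T R)
  (S : {RV P >-> nat})
  (S_range : forall w : T, (1 <= S w <= K)%N)
  (pK_gt0 : 0 < service_pmf S K)
  (S_var_gt0 : 0 < service_var S)
  (S_coprime : exists i j : nat,
     [/\ i != j, coprime i j & 0 < service_pmf S i * service_pmf S j])
  (beta ca : R) (beta_gt0 : 0 < beta) (ca_ge0 : 0 <= ca)
  (pistar : probability (R * K.-tuple R)%type R)
  (pistar_stationary :
     is_stationary_distribution (service_pmf S) (service_rate S) ca beta pistar)
  (theta : R) :
  let theta_star := 2 * beta / (ca ^+ 2 + service_cv S ^+ 2) in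
  (theta < theta_star -> ('E_pistar[fun x => expR (theta * x.1)] < +oo)%E) /\
  (theta_star < theta -> ('E_pistar[fun x => expR (theta * x.1)] = +oo)%E).
Proof.
have [d' [T' [P' [Q [L [A [J [chain law]]]]]]]] := pistar_stationary.
pose q i := service_pmf S i.+1.
have q_ge0 i : 0 <= q i by exact: service_pmf_ge0.
have q_sum1 : \sum_(i < K) q i = 1 by exact: service_pmf_sum1.
have q_out i : (K <= i)%N -> q i = 0.
  by move=> Ki; apply: (service_pmf_out S_range); rewrite ltnS Ki orbT.
pose m := \sum_(i < K) q i * work R i.
have m_ge1 : 1 <= m.
  rewrite -q_sum1; apply: ler_sum => i _; rewrite ler_peMr//.
  by rewrite /work ler1n.
have rateE : service_rate S = m^-1.
  by rewrite /service_rate (service_mean S_range).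
have mu_gt0 : 0 < service_rate S by rewrite rateE invr_gt0; lra.
have mu_mean : service_rate S * m = 1.
  by rewrite rateE mulVf// gt_eqF//; lra.
have cvE : service_cv S ^+ 2 = service_rate S ^+ 2 * wvar K q (work R).
  by rewrite /service_cv exprMn sqr_sqrtr ?(ltW S_var_gt0)// (service_varE S_range).
have [i [j [_ cij pij]]] := S_coprime.
have pmf_gt0 k : 0 < service_pmf S k -> exists2 l, k = l.+1 & (l < K)%N /\ 0 < q l.
  move=> pk; have := service_pmf_out S_range (k := k).
  case: k pk => [|k] pk Hk; first by rewrite Hk// ltxx in pk.
  exists k => //; split=> //; rewrite ltnNge; apply/negP => Kk.
  by rewrite Hk ?ltxx// ?ltnS ?Kk ?orbT// in pk.
have [pi_gt0 pj_gt0] : 0 < service_pmf S i /\ 0 < service_pmf S j.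
  have [pi0 pj0] := (service_pmf_ge0 S i, service_pmf_ge0 S j).
  by move: pij; rewrite !lt0r pi0 pj0 mulf_eq0 negb_or => /andP[/andP[-> ->]].
have [i' ei [iK qi]] := pmf_gt0 _ pi_gt0.
have [j' ej [jK qj]] := pmf_gt0 _ pj_gt0.
rewrite {}ei {}ej in cij.
have [rho [rho0 rho1 contract]] := renew_contraction q_ge0 q_sum1 cij iK jK qi qj.
have [D D0 W_contract] := contract (work R).
have c2_gt0 : 0 < ca ^+ 2 + service_cv S ^+ 2.
  rewrite ltr_wpDl ?sqr_ge0// cvE -(service_varE S_range).
  by rewrite mulr_gt0// exprn_gt0.
have mQL t : measurable_fun setT (fun w => (Q t w, L t w)).
  by apply: measurable_fun_pair; exact: measurable_funPT.
have mexp : measurable_fun setT (fun x : R * K.-tuple R => expR (theta * x.1)).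
  by apply: measurableT_comp => //; exact: measurable_funM.
(* The left side does not involve [t]: stationarity leaves the time free to be chosen in each case
   below. *)
have mgfE t : ('E_pistar[fun x => expR (theta * x.1)] =
    \int[P']_w (expR (theta * Q t w))%:E)%E.
  rewrite unlock (@integral_law _ _ _ _ _ P' _ pistar (mQL t) (law t))//.
  exact/measurable_EFinP.
move=> theta_star; split => th.
  have [th0|th0] := leP theta 0.
    (* Time 1 is taken because [Q 1] is a positive part, hence nonnegative. *)
    rewrite (mgfE 1%N); apply: le_lt_trans (ltry 1).
    rewrite -[leRHS](@expectation_cst _ _ _ P') unlock; apply: ge0_le_integral => //.
    - apply/measurable_EFinP; apply: measurableT_comp => //.
      by apply: measurable_funM => //; exact: measurable_funPT.
    - exact/measurable_EFinP.
    move=> w _; rewrite lee_fin expR_le1; apply: mulr_le0_ge0 => //.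
    have [_ _ _ _ /(_ 0%N w)[-> _]] := chain.
    by rewrite /next_queue le_max lexx orbT.
  have th_lt : theta * (ca ^+ 2 + service_rate S ^+ 2 * wvar K q (work R)) < 2 * beta.
    by rewrite -cvE -ltr_pdivlMr//; exact: th.
  have [C HC] := truncated_mgf_bounded q_ge0 q_sum1 q_out mu_gt0 mu_mean chain
    beta_gt0 ca_ge0 D0 rho0 rho1 W_contract th0 th_lt.
  apply: le_lt_trans (ltry C); rewrite unlock.
  apply: integral_le_of_truncations => // B B0.
  (* The time [t] depends on the truncation level [B], the bound [C] does not. *)
  have [t Ht] := HC B B0.
  rewrite (@integral_law _ _ _ _ _ P' _ pistar (mQL t) (law t))//.
    by apply/measurable_EFinP; exact: measurable_minr.
  by move=> x; rewrite lee_fin le_min expR_ge0.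
have th0 : 0 < theta.
  by apply: le_lt_trans th; rewrite divr_ge0 ?mulr_ge0// ltW.
have th_gt : 2 * beta < theta * (ca ^+ 2 + service_rate S ^+ 2 * wvar K q (work R)).
  by rewrite -cvE -ltr_pdivrMr//; exact: th.
(* One fixed stationary value exceeds every [y], through a time depending on [y]. *)
apply/eqyP => y _.
have [t Ht] := mgf_unbounded q_ge0 q_sum1 q_out mu_gt0 mu_mean chain
    beta_gt0 ca_ge0 D0 rho0 rho1 W_contract th0 th_gt y.
by rewrite (mgfE t).
Qed.
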